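(* Let $X$ and $Y$ be Banach spaces over $\mathbb{K}\in\{\mathbb{R},\mathbb{C}\}$, $\Gamma$ an arbitrary set, $E$ an invariant sequence space over $X$, and for each $\lambda\in\Gamma$ let $E_\lambda$ be a strongly invariant sequence space over $Y$. Suppose $f\colon X\to Y$ is compatible with $E_\lambda$ for every $\lambda\in\Gamma$, and that the family $(E_\lambda)_{\lambda\in\Gamma}$ is nested. Then the set $$G\big(E,f,(E_\lambda)_{\lambda\in\Gamma}\big)=\Big\{(x_j)_{j=1}^\infty\in E:\ (f(x_j))_{j=1}^\infty\notin\bigcup_{\lambda\in\Gamma}E_\lambda\Big\}$$ is either empty or pointwise $\mathfrak{c}$-spaceable in $E$; i.e., if it is nonempty, then for every $x\in G(E,f,(E_\lambda)_{\lambda\in\Gamma})$ there is a closed linear subspace $W_x$ of $E$ with $\dim W_x=\mathfrak{c}$ and $x\in W_x\subset G(E,f,(E_\lambda)_{\lambda\in\Gamma})\cup\{0\}$.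
   Context: $\mathfrak{c}=\operatorname{card}(\mathbb{R})$. Zero-free version: for $x=(x_j)_{j=1}^\infty\in Z^{\mathbb{N}}$ ($Z$ a Banach space), if $x$ has only finitely many nonzero coordinates then $x^0=0$; otherwise $x^0=(x_{j_k})_{k=1}^\infty$ where $x_{j_k}$ is the $k$-th nonzero coordinate of $x$. An invariant sequence space over a Banach space $Z\neq\{0\}$ is an infinite-dimensional Banach or quasi-Banach space $E$ which is a linear subspace of $Z^{\mathbb{N}}$ (coordinatewise operations) such that: (b1) there is a constant $K$ depending only on $E$ such that for all $x\in Z^{\mathbb{N}}$ with $x^0\neq0$, $x\in E\iff x^0\in E$, and $\|x\|_E\le K\|x^0\|_E$; (b2) $\|x_j\|_Z\le\|x\|_E$ for all $x=(x_j)\in E$ and all $j$. A strongly invariant sequence space over $Z$ is an invariant sequence space $E$ over $Z$ such that $c_{00}(Z)=\{(x_j)\in Z^{\mathbb{N}}: x_j=0\text{ for all but finitely many }j\}\subset E$, and $(x_j)_{j=1}^\infty\in E$ if and only if every subsequence of $(x_j)_{j=1}^\infty$ belongs to $E$. If $E'$ is an invariant sequence space over $Y$, a function $f\colon X\to Y$ with $f(0)=0$ is compatible with $E'$ if for every $X$-valued sequence $(x_j)_{j=1}^\infty$ and every scalar $a\neq0$: $(f(x_j))_{j=1}^\infty\notin E'\Rightarrow (f(ax_j))_{j=1}^\infty\notin E'$. A family $(E_\lambda)_{\lambda\in\Gamma}$ is nested if for all $\lambda_1,\lambda_2\in\Gamma$, either $E_{\lambda_1}\subset E_{\lambda_2}$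 or $E_{\lambda_2}\subset E_{\lambda_1}$. *)

(* Defs.v *)
From HB Require Import structures.
From mathcomp Require Import all_boot all_order all_algebra.
From mathcomp Require Import boolp classical_sets cardinality reals.
From mathcomp Require Import topology normedtype.
From mathcomp Require Import Rstruct Rstruct_topology.
From mathcomp Require Import complex.
From Stdlib Require Rdefinitions.

Set Implicit Arguments.
Unset Strict Implicit.
Unset Printing Implicit Defensive.
Import Order.TTheory GRing.Theory Num.Theory.
Local Open Scope classical_set_scope.
Local Open Scope ring_scope.

Definition KK (b : bool) : numFieldType :=
  if b then (Rdefinitions.R : numFieldType)
  else (complex Rdefinitions.R : numFieldType).


(* Sequences in Z^N are functions nat -> Z (index j = 1,2,... of the paper
   corresponds to j-1 here).  Pointwise (coordinatewise) operations.     *)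
Section SeqOps.
Variables (K : numFieldType) (Z : lmodType K).
Definition szero : nat -> Z := fun _ => 0.
Definition sadd (x y : nat -> Z) : nat -> Z := fun j => x j + y j.
Definition ssub (x y : nat -> Z) : nat -> Z := fun j => x j - y j.
Definition sscale (a : K) (x : nat -> Z) : nat -> Z := fun j => a *: x j.

Definition finsupp (x : nat -> Z) : Prop :=
  exists N, forall j, (N <= j)%N -> x j = 0.

Definition next_nz (x : nat -> Z) (n : nat) : nat :=
  match pselect (exists j, (n <= j)%N && (x j != 0)) with
  | left h => @ex_minn (fun j => (n <= j)%N && (x j != 0)) h
  | right _ => 0%N
  end.

Fixpoint nz_idx (x : nat -> Z) (k : nat) : nat :=
  match k with
  | 0%N => next_nz x 0
  | k'.+1 => next_nz x (nz_idx x k').+1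
  end.

Definition zero_free (x : nat -> Z) : nat -> Z :=
  if pselect (finsupp x) then szero else (fun k => x (nz_idx x k)).

Definition lin_subspace (A : set (nat -> Z)) : Prop :=
  [/\ A szero,
      (forall x y, A x -> A y -> A (sadd x y)) &
      (forall (a : K) x, A x -> A (sscale a x))].

Definition lspan (B : set (nat -> Z)) : set (nat -> Z) :=
  [set x | exists (n : nat) (c : 'I_n -> K) (v : 'I_n -> nat -> Z),
     (forall i, B (v i)) /\ x = (fun j => \sum_(i < n) c i *: v i j)].

Definition lin_indep (B : set (nat -> Z)) : Prop :=
  forall (n : nat) (c : 'I_n -> K) (v : 'I_n -> nat -> Z),
    injective v -> (forall i, B (v i)) ->
    (fun j => \sum_(i < n) c i *: v i j) = szero -> forall i, c i = 0.

Definition dim_continuum (W : set (nat -> Z)) : Prop :=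
  exists B : set (nat -> Z),
    [/\ B `<=` W, lin_indep B, lspan B = W & (B #= [set: Rdefinitions.R])%card].

Definition infinite_dimensional (E : set (nat -> Z)) : Prop :=
  ~ (exists B : set (nat -> Z), finite_set B /\ E `<=` lspan B).

Definition qconv (qn : (nat -> Z) -> K) (u : nat -> nat -> Z) (y : nat -> Z) :=
  forall e : K, 0 < e -> exists N, forall n, (N <= n)%N -> qn (ssub (u n) y) < e.

Definition qcauchy (qn : (nat -> Z) -> K) (u : nat -> nat -> Z) :=
  forall e : K, 0 < e -> exists N, forall m n, (N <= m)%N -> (N <= n)%N ->
    qn (ssub (u m) (u n)) < e.

(* (E, qn) is a Banach or quasi-Banach space: qn is a quasi-norm on the
   linear subspace E of Z^N (a norm is the case C = 1), and E is complete. *)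
Definition quasi_banach (E : set (nat -> Z)) (qn : (nat -> Z) -> K) : Prop :=
  [/\ lin_subspace E,
      (forall x, E x -> 0 <= qn x /\ (qn x = 0 <-> x = szero)),
      (forall (a : K) x, E x -> qn (sscale a x) = `|a| * qn x),
      (exists C : K, 1 <= C /\
         forall x y, E x -> E y -> qn (sadd x y) <= C * (qn x + qn y)) &
      (forall u : nat -> nat -> Z, (forall n, E (u n)) -> qcauchy qn u ->
         exists y, E y /\ qconv qn u y)].

Definition closed_subspace (E : set (nat -> Z)) (qn : (nat -> Z) -> K)
    (W : set (nat -> Z)) : Prop :=
  [/\ W `<=` E, lin_subspace W &
      (forall (u : nat -> nat -> Z) y, (forall n, W (u n)) -> E y ->
         qconv qn u y -> W y)].
End SeqOps.
Arguments szero {K Z}.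

Section SeqSpaces.
Variables (K : numFieldType).

Definition invariant_seq_space (Z : normedModType K)
    (E : set (nat -> Z)) (qn : (nat -> Z) -> K) : Prop :=
  [/\ exists z : Z, z != 0,
      quasi_banach E qn,
      infinite_dimensional E,
      (exists C : K, forall x : nat -> Z, zero_free x <> szero ->
         (E x <-> E (zero_free x)) /\ (E x -> qn x <= C * qn (zero_free x))) &
      (forall x, E x -> forall j, `|x j| <= qn x)].

Definition strongly_invariant_seq_space (Z : normedModType K)
    (E : set (nat -> Z)) (qn : (nat -> Z) -> K) : Prop :=
  [/\ invariant_seq_space E qn,
      (forall x : nat -> Z, finsupp x -> E x) &
      (forall x : nat -> Z, E x <->
         forall phi : nat -> nat, (forall n, (phi n < phi n.+1)%N) ->
           E (fun n => x (phi n)))].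

Definition compatible (X Y : normedModType K) (f : X -> Y)
    (E' : set (nat -> Y)) : Prop :=
  f 0 = 0 /\
  forall (x : nat -> X) (a : K), a != 0 ->
    ~ E' (fun j => f (x j)) -> ~ E' (fun j => f (a *: x j)).

Definition nested (Y : normedModType K) (Gam : Type)
    (EL : Gam -> set (nat -> Y)) : Prop :=
  forall l1 l2, EL l1 `<=` EL l2 \/ EL l2 `<=` EL l1.

Definition Gset (X Y : normedModType K) (Gam : Type) (E : set (nat -> X))
    (f : X -> Y) (EL : Gam -> set (nat -> Y)) : set (nat -> X) :=
  [set x | E x /\ ~ (exists l, EL l (fun j => f (x j)))].
End SeqSpaces.

(* Main.v *)
Require Import Defs.
From HB Require Import structures.
From mathcomp Require Import all_boot all_order all_algebra.
From mathcomp Require Import boolp classical_sets functions cardinality reals.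
From mathcomp Require Import topology normedtype.
From mathcomp Require Import Rstruct Rstruct_topology complex.
From mathcomp Require Import ring lra zify.

(** Let [x] be in the set.  Since the family is nested, the even or the odd
    part of [f x], say its values along [alpha], lies outside every [EL l].
    Place infinitely many disjoint copies of [x] on the indices missed by
    [alpha], and let [W] be the closure of the span of [x] and of these copies.
    Coordinates are continuous, so an element of [W] is a multiple of [x] along
    [alpha], and, when this multiple vanishes, a multiple of [x] along each
    copy; if it is nonzero, one of these multiples is, and compatibility and
    passage to subsequences keep [f w] out of every [EL l].  When [Gam] is
    empty the set is [E], and the closed span of any independent sequence
    containing [x] will do.

    In both cases [W] is the closed span of an independent sequence [v].  It has
    at most continuum many elements.  After rescaling [v] to a sequence [u] with
    fast decreasing tails, the sums of [u] over an almost disjoint family of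
    continuum many infinite subsets of [nat] are linearly independent: in a
    finite combination of them, infinitely many indices see only one
    coefficient.  This avoids linear functionals, which may be missing in a
    quasi-Banach space. *)

Set Implicit Arguments.
Unset Strict Implicit.
Unset Printing Implicit Defensive.
Import Order.TTheory GRing.Theory Num.Theory.
Local Open Scope classical_set_scope.
Local Open Scope ring_scope.

(** * Closed spans in quasi-Banach spaces *)

Section NullSequences.
Variable R : realType.

(** Only an upper bound is required: for nonnegative sequences this is convergence to 0, and
    comparison in [null_seq_le] needs no lower bound. *)
Definition null_seq (u : nat -> R) : Prop :=
  forall e : R, 0 < e -> exists n0, forall n, (n0 <= n)%N -> u n < e.

Lemma null_seqD u w : null_seq u -> null_seq w -> null_seq (fun n => u n + w n).
Proof.
move=> hu hw e e0; have e2 : 0 < e / 2 by lra.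
have [n1 h1] := hu _ e2; have [n2 h2] := hw _ e2.
exists (maxn n1 n2) => n; rewrite geq_max => /andP[/h1 ? /h2 ?]; lra.
Qed.

Lemma null_seqZ c u : 0 <= c -> null_seq u -> null_seq (fun n => c * u n).
Proof.
move=> c0 hu e e0; have c1 : 0 < c + 1 by lra.
have [n1 h1] := hu _ (divr_gt0 e0 c1).
exists n1 => n /h1; rewrite ltr_pdivlMr // => h.
have [un0|un0] := leP 0 (u n); first by nra.
by apply: le_lt_trans e0; rewrite nmulr_lle0.
Qed.

Lemma null_seq_le u w : (forall n, u n <= w n) -> null_seq w -> null_seq u.
Proof.
move=> uw hw e e0; have [n1 h1] := hw _ e0; exists n1 => n /h1.
exact: le_lt_trans.
Qed.

Lemma null_seq_const x : 0 <= x -> null_seq (fun=> x) -> x = 0.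
Proof.
move=> x0 hx; apply/eqP; rewrite eq_le x0 andbT leNgt; apply/negP => /hx[n h].
by have := h n (leqnn n); rewrite ltxx.
Qed.

Lemma null_seq_inv : null_seq (fun n => n.+1%:R^-1).
Proof.
move=> e e0; exists (Num.bound e^-1) => n hn.
rewrite invf_plt ?posrE //; apply: lt_le_trans (_ : (Num.bound e^-1)%:R <= _).
  by rewrite archi_boundP // invr_ge0 ltW.
by rewrite ler_nat (leq_trans hn).
Qed.

End NullSequences.

(** The number with binary digits 1, [b 0], ..., [b (n-1)]. The leading 1 makes the length of the
    prefix recoverable from the code. *)
Fixpoint prefix_code (b : nat -> bool) n : nat :=
  if n is m.+1 then (prefix_code b m).*2 + b m else 1.

Lemma prefix_code_gt0 b n : (0 < prefix_code b n)%N.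
Proof. by elim: n => //= n IH; rewrite addn_gt0 double_gt0 IH. Qed.

Lemma prefix_code_ge b n : (n <= prefix_code b n)%N.
Proof. elim: n => //= n IH; have := prefix_code_gt0 b n; lia. Qed.

Lemma prefix_code_inj b b' n n' : prefix_code b n = prefix_code b' n' ->
  n = n' /\ forall i, (i < n)%N -> b i = b' i.
Proof.
elim: n n' => [|n IH] [|n'] //=.
- have := prefix_code_gt0 b' n'; lia.
- have := prefix_code_gt0 b n; lia.
move=> h; have hb : b n = b' n' by case: (b n) h; case: (b' n') => //; lia.
move: h; rewrite hb => /addIn/double_inj/IH[nn' hi]; rewrite -nn' in hb *.
split=> // i; rewrite ltnS leq_eqVlt => /orP[/eqP ->//|]; exact: hi.
Qed.

(* The sets of prefix codes form an almost disjoint family of infinite subsets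
   of [nat] indexed by the binary sequences. *)
Definition prefix_codes (b : nat -> bool) (k : nat) : bool :=
  [exists n : 'I_k.+1, prefix_code b n == k].

(** This gives almost disjointness: once [b] and [b'] differ at some index, no code of a longer
    prefix of [b] belongs to the set of [b']. *)
Lemma prefix_codesP b b' n :
  prefix_codes b' (prefix_code b n) <-> (forall i, (i < n)%N -> b i = b' i).
Proof.
split=> [/existsP[m /eqP/esym/prefix_code_inj[]]//|h].
have hn : (n < (prefix_code b n).+1)%N by rewrite ltnS prefix_code_ge.
apply/existsP; exists (Ordinal hn) => /=; apply/eqP.
elim: n h {hn} => //= n IH h; rewrite h // IH // => i lin; apply: h.
exact: leqW.
Qed.

(** * Quasi-Banach spaces over a complete valued field, with real-valued quasi-norm *)

Section QuasiBanach.
Variables (R : realType) (K : fieldType) (abs : K -> R).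
Hypothesis abs_ge0 : forall a, 0 <= abs a.
Hypothesis abs_eq0 : forall a, abs a = 0 -> a = 0.
Hypothesis abs0 : abs 0 = 0.
Hypothesis abs1 : abs 1 = 1.
Hypothesis absN : forall a, abs (- a) = abs a.
Hypothesis absM : forall a b, abs (a * b) = abs a * abs b.
Hypothesis abs_complete : forall a : nat -> K,
  (forall e : R, 0 < e -> exists n0, forall m n, (n0 <= m)%N -> (n0 <= n)%N ->
     abs (a m - a n) < e) ->
  exists l, null_seq (fun n => abs (a n - l)).
(** Supplies a scalar of each nonnegative modulus, for rescaling vectors. *)
Variable ofR : R -> K.
Hypothesis abs_ofR : forall r : R, 0 <= r -> abs (ofR r) = r.
Variables (V : lmodType K) (E : set V) (N : V -> R) (C : R).
Hypothesis E0 : E 0.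
Hypothesis ED : forall x y, E x -> E y -> E (x + y).
Hypothesis EZ : forall a x, E x -> E (a *: x).
Hypothesis N_ge0 : forall x, E x -> 0 <= N x.
Hypothesis N_eq0 : forall x, E x -> N x = 0 -> x = 0.
Hypothesis NZ : forall a x, E x -> N (a *: x) = abs a * N x.
Hypothesis C1 : (1 : R) <= C.
Hypothesis ND : forall x y, E x -> E y -> N (x + y) <= C * (N x + N y).
Hypothesis E_complete : forall u : nat -> V, (forall n, E (u n)) ->
  (forall e : R, 0 < e -> exists n0, forall m n, (n0 <= m)%N -> (n0 <= n)%N ->
     N (u m - u n) < e) ->
  exists y, E y /\ null_seq (fun n => N (u n - y)).

Lemma subspaceN x : E x -> E (- x).
Proof. by move=> Ex; rewrite -scaleN1r; apply: EZ. Qed.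

Lemma subspaceB x y : E x -> E y -> E (x - y).
Proof. by move=> Ex Ey; apply: ED => //; apply: subspaceN. Qed.

Lemma qnormN x : E x -> N (- x) = N x.
Proof. by move=> Ex; rewrite -scaleN1r NZ // absN abs1 mul1r. Qed.

Lemma qnorm0 : N 0 = 0.
Proof. by rewrite -(scale0r 0) NZ // abs0 mul0r. Qed.

Lemma qnormB x y : E x -> E y -> N (x - y) <= C * (N x + N y).
Proof.
by move=> Ex Ey; rewrite -(qnormN Ey) //; apply: ND => //; apply: subspaceN.
Qed.

Lemma qnorm_dist x y z : E x -> E y -> E z ->
  N (x - z) <= C * (N (x - y) + N (y - z)).
Proof.
move=> Ex Ey Ez; have -> : x - z = (x - y) + (y - z) by rewrite addrA subrK.
by apply: ND; apply: subspaceB.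
Qed.

Lemma qlim_unique u x y : (forall n, E (u n)) -> E x -> E y ->
  null_seq (fun n => N (u n - x)) -> null_seq (fun n => N (u n - y)) ->
  x = y.
Proof.
move=> Eu Ex Ey ux uy; apply/subr0_eq/N_eq0; first exact: subspaceB.
apply: null_seq_const; first by apply/N_ge0/subspaceB.
have C0 : 0 <= C := le_trans ler01 C1.
apply: null_seq_le (null_seqZ C0 (null_seqD ux uy)) => n.
by rewrite -(@qnormN (u n - x)) ?opprB; [exact: qnorm_dist|exact: subspaceB].
Qed.

Implicit Types (v : nat -> V) (a : nat -> K).

Definition lincomb (v : nat -> V) (a : nat -> K) n := \sum_(k < n) a k *: v k.

Lemma lincomb_in v a n : (forall k, E (v k)) -> E (lincomb v a n).
Proof.
move=> Ev; rewrite /lincomb; elim/big_ind : _ => // k _; exact: EZ.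
Qed.

Lemma lincombS v a n : lincomb v a n.+1 = lincomb v a n + a n *: v n.
Proof. by rewrite /lincomb big_ord_recr. Qed.

Lemma lincombD v a (b : nat -> K) n :
  lincomb v (fun k => a k + b k) n = lincomb v a n + lincomb v b n.
Proof.
by rewrite /lincomb -big_split; apply: eq_bigr => k _; rewrite scalerDl.
Qed.

Lemma lincombZ v c a n : lincomb v (fun k => c * a k) n = c *: lincomb v a n.
Proof.
by rewrite /lincomb scaler_sumr; apply: eq_bigr => k _; rewrite scalerA.
Qed.

Lemma lincombB v a (b : nat -> K) n :
  lincomb v (fun k => a k - b k) n = lincomb v a n - lincomb v b n.
Proof.
by rewrite /lincomb -sumrB; apply: eq_bigr => k _; rewrite scalerBl.
Qed.

Lemma eq_lincomb v a (b : nat -> K) n : (forall k, (k < n)%N -> a k = b k) ->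
  lincomb v a n = lincomb v b n.
Proof. by move=> ab; apply: eq_bigr => k _; rewrite ab. Qed.

Lemma lincomb_null v (a : nat -> nat -> K) n : (forall k, E (v k)) ->
  (forall k, (k < n)%N -> null_seq (fun m => abs (a m k))) ->
  null_seq (fun m => N (lincomb v (a m) n)).
Proof.
move=> Ev; have C0 : 0 <= C := le_trans ler01 C1.
elim: n => [|n IH] ha.
  apply: (@null_seq_le _ _ (fun=> 0)); last by move=> e e0; exists 0%N.
  by move=> m; rewrite /lincomb big_ord0 qnorm0.
have IHn : null_seq (fun m => N (lincomb v (a m) n)).
  by apply: IH => k kn; apply: ha; rewrite ltnS ltnW.
have hn := null_seqZ (N_ge0 (Ev n)) (ha n (ltnSn n)).
apply: null_seq_le (null_seqZ C0 (null_seqD IHn hn)) => m.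
rewrite lincombS (le_trans (ND (lincomb_in _ _ Ev) (EZ _ (Ev n))))//.
by rewrite NZ // (mulrC (abs _)).
Qed.

Definition independent (v : nat -> V) := forall n a,
  lincomb v a n = 0 -> forall k, (k < n)%N -> a k = 0.

(* Quantitative independence: the coordinate functionals of a finite
   dimensional subspace are continuous. *)
Lemma coef_bound v n : (forall k, E (v k)) -> independent v ->
  exists2 d, 0 < d <= 1 &
    forall a k, (k < n)%N -> d * abs (a k) <= N (lincomb v a n).
Proof.
move=> Ev indv; have C0 : 0 <= C := le_trans ler01 C1.
elim: n => [|n [d /andP[d0 d1] Hd]].
  by exists 1; rewrite ?ltr01 ?lexx.
(* [v n] stays at a positive distance from the span of its predecessors. Otherwise some combinations
   [lincomb v (a m) n + v n] tend to 0; by the induction hypothesis their coefficients are Cauchy,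
   and the limit is a linear relation in which [v n] has coefficient 1. *)
have [r r0 Hr] : exists2 r, 0 < r & forall a, r <= N (lincomb v a n + v n).
  apply: contrapT => Hno.
  have /choice[a Ha] : forall m : nat, exists a,
      N (lincomb v a n + v n) < m.+1%:R^-1.
    move=> m; apply: contrapT => Hm; apply: Hno; exists m.+1%:R^-1 => [|a].
      by rewrite invr_gt0.
    by rewrite leNgt; apply/negP => ?; apply: Hm; exists a.
  have Eav m : E (lincomb v (a m) n + v n) by apply: ED => //; exact: lincomb_in.
  have nullav : null_seq (fun m => N (lincomb v (a m) n + v n)).
    by apply: null_seq_le (@null_seq_inv R) => m; apply: ltW.
  have /choice[l Hl] : forall k, exists l,
      (k < n)%N -> null_seq (fun m => abs (a m k - l)).
    move=> k; case: (ltnP k n) => [kn|_]; last by exists 0.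
    suff /abs_complete[l Hl] : forall e : R, 0 < e -> exists n0, forall m p,
        (n0 <= m)%N -> (n0 <= p)%N -> abs (a m k - a p k) < e.
      by exists l.
    move=> e e0.
    have [n0 Hn0] := null_seqZ C0 nullav (divr_gt0 (mulr_gt0 d0 e0) (@ltr0Sn R 1)).
    exists n0 => m p /Hn0 hm /Hn0 hp.
    have := Hd (fun k => a m k - a p k) k kn.
    rewrite lincombB (_ : _ - _ =
      (lincomb v (a m) n + v n) - (lincomb v (a p) n + v n)); last first.
      by rewrite opprD addrACA subrr addr0.
    move=> h; rewrite -(ltr_pM2l d0); apply: le_lt_trans h _.
    by apply: le_lt_trans (qnormB (Eav m) (Eav p)) _; lra.
  have Elv : E (lincomb v l n + v n) by apply: ED => //; exact: lincomb_in.
  have lv0 : lincomb v l n + v n = 0.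
    apply: (@qlim_unique (fun m => lincomb v (a m) n + v n)) => //; last first.
      by move: nullav; under [in X in X -> _]eq_fun do rewrite -[X in N X]subr0.
    have := @lincomb_null v (fun m k => a m k - l k) n Ev Hl.
    apply: null_seq_le => m; rewrite lincombB.
    by rewrite opprD addrACA subrr addr0.
  have := indv n.+1 (fun k => if (k < n)%N then l k else 1).
  rewrite lincombS ltnn scale1r.
  rewrite (@eq_lincomb _ _ l) ?lv0; last by move=> k ->.
  by move=> /(_ erefl n (ltnSn n)); rewrite ltnn => /eqP; rewrite oner_eq0.
have Hn a : r * abs (a n) <= N (lincomb v a n.+1).
  have [a0|an0] := eqVneq (a n) 0.
    by rewrite a0 abs0 mulr0 N_ge0 //; exact: lincomb_in.
  have := Hr (fun k => (a n)^-1 * a k); rewrite lincombZ.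
  rewrite -[v n in X in X -> _]scale1r -(mulVf an0) -scalerA -scalerDr -lincombS.
  rewrite NZ; last exact: lincomb_in.
  move=> h; rewrite mulrC.
  rewrite -[leRHS]mul1r -abs1 -(mulfV an0) absM -mulrA.
  by apply: ler_wpM2l.
(* Removing the term [a n *: v n], whose coefficient is controlled by [r], multiplies the quasi-norm
   by at most [M]. Hence [d / M] serves the earlier coefficients and [r] the last one. *)
pose M := C * (1 + N (v n) / r).
have Nv0 := N_ge0 (Ev n).
have q0 : 0 <= N (v n) / r by rewrite divr_ge0 // ltW.
have M1 : 1 <= M by rewrite /M mulr_ege1 // lerDl.
exists (Num.min (Num.min r 1) (d / M)).
  rewrite !lt_min r0 ltr01 /= divr_gt0 /=; [|lra|lra].
  by rewrite !ge_min lexx orbT.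
move=> a k; rewrite ltnS leq_eqVlt => /orP[/eqP ->|kn].
  apply: le_trans (Hn a); apply: ler_wpM2r => //.
  by rewrite !ge_min lexx.
apply: (@le_trans _ _ (d / M * abs (a k))).
  by apply: ler_wpM2r => //; rewrite !ge_min lexx orbT.
rewrite mulrAC ler_pdivrMr; last lra.
apply: le_trans (Hd a k kn) _.
have Ea m := lincomb_in a m Ev.
rewrite (_ : lincomb v a n = lincomb v a n.+1 - a n *: v n); last first.
  by rewrite lincombS addrK.
apply: le_trans (qnormB (Ea _) (EZ _ (Ev n))) _.
rewrite NZ // /M mulrCA; apply: ler_wpM2l => //.
rewrite mulrDr mulr1 lerD2l mulrCA (mulrC (abs _)).
apply: ler_wpM2l => //.
by rewrite ler_pdivlMr // mulrC.
Qed.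

(* For bounded [a], [s n.+1] controls the tail [sum_(k > n) a_k u_k], yet is
   negligible with respect to the partial sum [sum_(k <= n) a_k u_k] when [a_n]
   is bounded away from 0. *)
Lemma fast_rescaling v : (forall k, E (v k)) -> independent v ->
  exists (u : nat -> V) (s : nat -> R),
  [/\ forall k, E (u k),
      forall a n, exists b : nat -> K, lincomb u a n = lincomb v b n,
      forall n, 0 < s n <= n.+1%:R^-1,
      forall n, C * (N (u n) + s n.+1) <= s n &
      forall a n, n.+2%:R * abs (a n) * s n.+1 <= N (lincomb u a n.+1)].
Proof.
move=> Ev indv; have C0 : 0 < C := lt_le_trans ltr01 C1.
have /choice[d Hd] : forall n, exists d : R, 0 < d <= 1 /\
    forall a, d * abs (a n) <= N (lincomb v a n.+1).
  move=> n; have [d d01 Hd] := coef_bound n.+1 Ev indv.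
  by exists d; split=> // a; exact: Hd.
pose B n := 2 * C * (N (v n) + 1).
have B2 n : 2 <= B n.
  rewrite /B -mulrA ler_peMr // mulr_ege1 // lerDr; exact: N_ge0.
have B0 n : 0 < B n by apply: lt_le_trans (B2 n).
(* The rescaled vector is [u n = e n *: v n] with [e n = s n / B n]. The constant [B n] makes
   [C * (e n * (N (v n) + 1))] equal to [s n / 2], and the factor [d n / n.+2%:R] in [s n.+1] is the
   one that turns the coefficient bound into the last claim. *)
pose s := fix s n := if n is m.+1 then d m * (s m / B m) / m.+2%:R else 1.
pose e n := s n / B n.
have sS n : s n.+1 = d n * e n / n.+2%:R by [].
have s01 n : 0 < s n <= n.+1%:R^-1.
  elim: n => [|n /andP[s0 s1]]; first by rewrite /= ltr01 invr1 lexx.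
  have [/andP[d0 d1] _] := Hd n.
  have e0 : 0 < e n by rewrite divr_gt0.
  rewrite sS; apply/andP; split; first by rewrite divr_gt0 // mulr_gt0.
  rewrite ler_pdivrMr // mulVf ?pnatr_eq0 //.
  apply: mulr_ile1 => //; try exact: ltW.
  rewrite ler_pdivrMr // mul1r; apply: le_trans s1 _.
  apply: le_trans (_ : 1 <= _); last by apply: le_trans (B2 n); rewrite ler1n.
  by rewrite invf_le1 // ler1n.
have e0 n : 0 < e n by have /andP[s0 _] := s01 n; rewrite divr_gt0.
have absE n : abs (ofR (e n)) = e n by rewrite abs_ofR // ltW.
exists (fun k => ofR (e k) *: v k), s; split => //.
- by move=> k; apply: EZ.
- move=> a n; exists (fun k => a k * ofR (e k)).
  by apply: eq_bigr => k _; rewrite scalerA.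
- move=> n; rewrite NZ // absE.
  have [/andP[d0 d1] _] := Hd n.
  have sle : s n.+1 <= e n.
    rewrite sS ler_pdivrMr // mulrC ler_pM //; try exact: ltW.
    by apply: le_trans d1 _; rewrite ler1n.
  apply: (@le_trans _ _ (C * (e n * (N (v n) + 1)))).
    by apply: ler_wpM2l; [exact: ltW | rewrite mulrDr mulr1 lerD2l].
  have Nv1 : 0 < N (v n) + 1 by apply: ltr_wpDl; [exact: N_ge0|].
  have /andP[s0 _] := s01 n.
  rewrite (_ : C * _ = s n / 2); last first.
    by rewrite /e /B; field; rewrite !gt_eqF.
  lra.
- move=> a n; have [/andP[d0 d1] Hdn] := Hd n.
  have := Hdn (fun k => a k * ofR (e k)).
  rewrite (_ : lincomb v _ _ = lincomb (fun k => ofR (e k) *: v k) a n.+1).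
    apply: le_trans; rewrite absM absE sS le_eqVlt; apply/orP; left; apply/eqP.
    have : n.+2%:R != 0 :> R by rewrite pnatr_eq0.
    by move: (n.+2%:R) => q q0; field.
  by apply: eq_bigr => k _; rewrite scalerA.
Qed.

(** * Sums of series with fast decreasing tails *)

Section FastSeries.
Variables (u : nat -> V) (s : nat -> R).
Hypothesis Eu : forall k, E (u k).
Hypothesis s_bounds : forall n, 0 < s n <= n.+1%:R^-1.
Hypothesis us : forall n, C * (N (u n) + s n.+1) <= s n.
Hypothesis su : forall a n,
  n.+2%:R * abs (a n) * s n.+1 <= N (lincomb u a n.+1).

(** [y] is the sum of the series with coefficients [a], with remainders of order [s n]. The free
    constant [M] makes the relation stable under linear combinations, where coefficients may exceed
    1. *)
Definition expands a y :=
  E y /\ exists2 M, 0 <= M & forall n, N (y - lincomb u a n) <= M * s n.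

Lemma expands_exists a : (forall k, abs (a k) <= 1) -> exists y, expands a y.
Proof.
move=> a1; have C0 : 0 < C := lt_le_trans ltr01 C1.
have Es n : E (lincomb u a n) by exact: lincomb_in.
have s0 n : 0 < s n by have /andP[] := s_bounds n.
(* The first term of the block is split off, not the last: the factor [C] is then absorbed by [us]
   at every step and does not accumulate. *)
have tail n m : N (lincomb u a (n + m) - lincomb u a n) <= s n.
  elim: m n => [|m IH] n; first by rewrite addn0 subrr qnorm0 ltW.
  rewrite (_ : _ - _ = a n *: u n + (lincomb u a (n.+1 + m) - lincomb u a n.+1)).
    apply: le_trans (us n).
    have Eau := EZ (a n) (Eu n).
    apply: le_trans (ND Eau (subspaceB (Es (n.+1 + m)%N) (Es n.+1))) _.
    rewrite NZ // ler_pM2l //; apply: lerD (IH _).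
    by rewrite ler_piMl // N_ge0.
  by rewrite addSnnS (lincombS u a n) opprD addrCA (addrC (- lincomb u a n)) addNKr.
have tail2 n0 m p : (n0 <= m)%N -> (n0 <= p)%N ->
    N (lincomb u a m - lincomb u a p) <= C * (s n0 + s n0).
  move=> /subnKC <- /subnKC <-.
  apply: le_trans (qnorm_dist (Es _) (Es n0) (Es _)) _.
  rewrite ler_pM2l //; apply: lerD => //.
  by rewrite -qnormN ?opprB //; exact: subspaceB.
have null_s : null_seq s.
  by apply: null_seq_le (@null_seq_inv R) => n; have /andP[] := s_bounds n.
have [e e0|y [Ey ylim]] := E_complete Es.
  have [n0 Hn0] := null_seqZ (ltW C0) (null_seqD null_s null_s) e0.
  exists n0 => m p hm hp; apply: le_lt_trans (tail2 _ _ _ hm hp) _; exact: Hn0.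
exists y; split=> //; exists (2 * C); first by rewrite mulr_ge0 // ltW.
move=> n; have [n0 Hn0] := ylim _ (s0 n).
apply: le_trans (qnorm_dist Ey (Es (n + n0)%N) (Es n)) _.
rewrite (mulrC 2) -mulrA ler_pM2l // mulr_natl mulr2n; apply: lerD => //.
rewrite -qnormN ?opprB; last exact: subspaceB.
by apply/ltW/Hn0; rewrite leq_addl.
Qed.

Lemma expandsD a (b : nat -> K) y z :
  expands a y -> expands b z -> expands (fun k => a k + b k) (y + z).
Proof.
move=> [Ey [M M0 HM]] [Ez [M' M'0 HM']]; have C0 : 0 <= C := le_trans ler01 C1.
split; first exact: ED.
exists (C * (M + M')); first by rewrite mulr_ge0 // addr_ge0.
move=> n; rewrite lincombD opprD addrACA.
have Es c := lincomb_in c n Eu.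
apply: le_trans (ND (subspaceB Ey (Es _)) (subspaceB Ez (Es _))) _.
by rewrite -mulrA ler_wpM2l // mulrDl; apply: lerD.
Qed.

Lemma expandsZ c a y : expands a y -> expands (fun k => c * a k) (c *: y).
Proof.
move=> [Ey [M M0 HM]]; split; first exact: EZ.
exists (abs c * M); first exact: mulr_ge0.
move=> n; rewrite lincombZ -scalerBr NZ -?mulrA ?ler_wpM2l //.
by apply: subspaceB => //; exact: lincomb_in.
Qed.

Lemma expands_sum m (c : 'I_m -> K) (a : 'I_m -> nat -> K) (y : 'I_m -> V) :
  (forall i, expands (a i) (y i)) ->
  expands (fun k => \sum_(i < m) c i * a i k) (\sum_(i < m) c i *: y i).
Proof.
elim: m c a y => [|m IH] c a y h.
  rewrite big_ord0; split=> //; exists 0 => // n.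
  rewrite (_ : lincomb _ _ _ = 0) ?subrr ?qnorm0 ?mul0r //.
  by rewrite /lincomb big1 // => k _; rewrite big_ord0 scale0r.
rewrite big_ord_recr; under eq_fun do rewrite big_ord_recr.
by apply: expandsD; [exact: IH | exact: expandsZ].
Qed.

(** When the sum is 0, the partial sums are themselves remainders, at most [M * s n.+1], while [su]
    bounds them below by [n.+2%:R * abs (a n) * s n.+1]. So the coefficients of a vanishing series
    tend to 0. *)
Lemma expands0_bounded a : expands a 0 ->
  exists M : R, forall n, n%:R * abs (a n) <= M.
Proof.
move=> [_ [M M0 HM]]; exists M => n.
have /andP[s0 _] := s_bounds n.+1.
rewrite -(ler_pM2r s0); apply: le_trans (HM n.+1).
rewrite sub0r qnormN; last exact: lincomb_in.
apply: le_trans (su a n); rewrite ler_pM2r //; apply: ler_wpM2r => //.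
by rewrite ler_nat leqW.
Qed.

(** In a vanishing combination, the coefficient of the series at the code of a long prefix of [b i]
    is exactly [c i]. There are infinitely many such codes and the coefficients tend to 0, so
    [c i = 0]. *)
Lemma independent_prefix_family : exists w : (nat -> bool) -> V,
  (forall b, exists a, expands a (w b)) /\
  forall m (c : 'I_m -> K) (b : 'I_m -> nat -> bool), injective b ->
    \sum_(i < m) c i *: w (b i) = 0 -> forall i, c i = 0.
Proof.
have /choice[w Hw] : forall b, exists y,
    expands (fun k => (prefix_codes b k)%:R) y.
  move=> b; apply: expands_exists => k.
  by case: prefix_codes; rewrite ?abs0 ?abs1.
exists w; split=> [b|m c b injb sum0 i]; first by eexists; exact: Hw.
have [M HM] : exists M : R, forall n,
    n%:R * abs (\sum_(j < m) c j * (prefix_codes (b j) n)%:R) <= M.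
  by apply: expands0_bounded; rewrite -sum0; apply: expands_sum.
have /choice[p Hp] : forall j, exists p, j != i -> b i p != b j p.
  move=> j; apply: contrapT => h; have ji : j != i.
    by apply: contrapT => ji; apply: h; exists 0%N => /ji.
  move/eqP: ji; apply; apply: injb; apply/funext => q.
  by apply/esym/eqP; apply: contrapT => bq; apply: h; exists q => _; exact/negP.
(* Since [p j] is an index where [b j] differs from [b i], prefixes of [b i] of length at least [n0]
   are prefixes of no other [b j]. *)
pose n0 := (\max_(j < m) p j).+1.
have cM n : (n0 <= n)%N -> n%:R * abs (c i) <= M.
  move=> n0n; apply: le_trans (HM (prefix_code (b i) n)).
  rewrite (bigD1 i) //= big1 ?addr0 => [|j ji].
    rewrite (_ : prefix_codes _ _) ?mulr1; last exact/prefix_codesP.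
    by apply: ler_wpM2r => //; rewrite ler_nat prefix_code_ge.
  case: (boolP (prefix_codes _ _)) => [/prefix_codesP/(_ (p j))|]; last first.
    by rewrite mulr0.
  have pn : (p j < n)%N.
    by apply: leq_trans n0n; rewrite ltnS; exact: leq_bigmax.
  by move=> /(_ pn) e; have := Hp j ji; rewrite e eqxx.
apply: abs_eq0; apply/eqP; rewrite eq_le abs_ge0 andbT leNgt; apply/negP => c0.
have := cM _ (leq_maxl n0 (Num.bound `|M / abs (c i)|)).
apply/negP; rewrite -ltNge -ltr_pdivrMr //.
apply: le_lt_trans (ler_norm _) _; apply: lt_le_trans (archi_boundP _) _ => //.
by rewrite ler_nat leq_maxr.
Qed.

End FastSeries.

(** * The closure of the span of a sequence *)

Definition span_closure v : set V := [set y | E y /\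
  forall e : R, 0 < e -> exists n a, N (y - lincomb v a n) < e].

Lemma continuum_family v : (forall k, E (v k)) -> independent v ->
  exists w : (nat -> bool) -> V, (forall b, span_closure v (w b)) /\
  forall m (c : 'I_m -> K) (b : 'I_m -> nat -> bool), injective b ->
    \sum_(i < m) c i *: w (b i) = 0 -> forall i, c i = 0.
Proof.
move=> Ev indv; have [u [s [Eu uv sb us su]]] := fast_rescaling Ev indv.
have [w [Hw indw]] := independent_prefix_family Eu sb us su.
exists w; split=> // b; have [a [Ew [M M0 HM]]] := Hw b; split=> // e e0.
have null_s : null_seq s.
  by apply: null_seq_le (@null_seq_inv R) => n; have /andP[] := sb n.
have [n Hn] := null_seqZ M0 null_s e0.
have [a' ua'] := uv a n; exists n, a'; rewrite -ua'.
by apply: le_lt_trans (HM n) _; exact: Hn.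
Qed.

Lemma lincomb_widen v a n m : (n <= m)%N ->
  lincomb v a n = lincomb v (fun k => if (k < n)%N then a k else 0) m.
Proof.
move=> /subnKC <-; elim: (m - n)%N => [|p IH].
  by rewrite addn0; apply: eq_lincomb => k ->.
by rewrite addnS lincombS -IH ltnNge leq_addr scale0r addr0.
Qed.

Lemma span_closure_gen v k : (forall k, E (v k)) -> span_closure v (v k).
Proof.
move=> Ev; split=> // e e0; exists k.+1, (fun j => (j == k)%:R).
rewrite lincombS eqxx scale1r (_ : lincomb _ _ _ = 0) ?add0r ?subrr ?qnorm0 //.
by rewrite /lincomb big1 // => i _; rewrite ltn_eqF // scale0r.
Qed.

Lemma span_closureZ v c y : (forall k, E (v k)) ->
  span_closure v y -> span_closure v (c *: y).
Proof.
move=> Ev [Ey hy]; split=> [|e e0]; first exact: EZ.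
have c1 : 0 < abs c + 1 by rewrite ltr_wpDl.
have [n [a h]] := hy _ (divr_gt0 e0 c1); exists n, (fun k => c * a k).
have Es := lincomb_in a n Ev.
rewrite lincombZ -scalerBr NZ; last exact: subspaceB.
move: h; rewrite ltr_pdivlMr // mulrC; apply: le_lt_trans.
by apply: ler_wpM2r; [apply/N_ge0/subspaceB | rewrite lerDl].
Qed.

Lemma span_closureD v y z : (forall k, E (v k)) ->
  span_closure v y -> span_closure v z -> span_closure v (y + z).
Proof.
move=> Ev [Ey hy] [Ez hz]; split=> [|e e0]; first exact: ED.
have C0 : 0 < C := lt_le_trans ltr01 C1.
have e2 : 0 < e / (2 * C) by rewrite divr_gt0 // mulr_gt0.
have [n [a ha]] := hy _ e2; have [m [b hb]] := hz _ e2.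
rewrite (lincomb_widen _ _ (leq_maxl n m)) in ha.
rewrite (lincomb_widen _ _ (leq_maxr n m)) in hb.
exists (maxn n m), (fun k => (if (k < n)%N then a k else 0) +
  (if (k < m)%N then b k else 0)); rewrite lincombD opprD addrACA.
have Es c := lincomb_in c (maxn n m) Ev.
apply: le_lt_trans (ND (subspaceB Ey (Es _)) (subspaceB Ez (Es _))) _.
rewrite mulrC -ltr_pdivlMr // (_ : e / C = e / (2 * C) + e / (2 * C)).
  exact: ltrD ha hb.
by field; rewrite gt_eqF.
Qed.

Lemma span_closure_closed v (x : nat -> V) y : (forall k, E (v k)) -> E y ->
  (forall n, span_closure v (x n)) -> null_seq (fun n => N (x n - y)) ->
  span_closure v y.
Proof.
move=> Ev Ey Wx xy; split=> // e e0; have C0 : 0 < C := lt_le_trans ltr01 C1.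
have e2 : 0 < e / (2 * C) by rewrite divr_gt0 // mulr_gt0.
have [n /(_ n (leqnn n)) hn] := xy _ e2.
have [Ex /(_ _ e2) [m [a ha]]] := Wx n; exists m, a.
apply: le_lt_trans (qnorm_dist Ey Ex (lincomb_in _ _ Ev)) _.
rewrite mulrC -ltr_pdivlMr // (_ : e / C = e / (2 * C) + e / (2 * C)).
  by apply: ltrD ha; rewrite -qnormN ?opprB //; exact: subspaceB.
by field; rewrite gt_eqF.
Qed.

(** An element is determined by a sequence of finite combinations converging to it, that is, by
    countably many lengths and scalars, each coded by bits. This bounds the cardinality by the
    continuum. *)
Lemma span_closure_inj v (kc : K -> nat -> bool) :
  (forall k, E (v k)) -> injective kc ->
  exists g : V -> nat * nat * nat -> bool, {in span_closure v &, injective g}.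
Proof.
move=> Ev injkc.
have approx y : exists na : nat -> nat * (nat -> K), span_closure v y ->
    null_seq (fun m => N (lincomb v (na m).2 (na m).1 - y)).
  have [[Ey hy]|] := pselect (span_closure v y); last by exists (fun=> (0%N, fun=> 0)).
  have /choice[na Hna] : forall m : nat, exists na : nat * (nat -> K),
      N (y - lincomb v na.2 na.1) < m.+1%:R^-1.
    move=> m; have [|n [a h]] := hy m.+1%:R^-1; first by rewrite invr_gt0.
    by exists (n, a).
  exists na => _; apply: null_seq_le (@null_seq_inv R) => m.
  rewrite -qnormN ?opprB; first exact: ltW.
  by apply: subspaceB => //; exact: lincomb_in.
have [na Hna] := choice approx.
(* For the [m]-th approximation, [k = 0] gives its length in unary and [k = k'.+1] the bits of its
   coefficient of index [k']. *)
exists (fun y t => let: (m, k, j) := t in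
  if k is k'.+1 then kc ((na y m).2 k') j else (j < (na y m).1)%N).
move=> y z /set_mem Wy /set_mem Wz e.
have e1 m : (na y m).1 = (na z m).1.
  have h j : (j < (na y m).1)%N = (j < (na z m).1)%N.
    exact: (congr1 (fun f => f (m, 0%N, j)) e).
  apply/eqP; rewrite eqn_leq; apply/andP; split; rewrite leqNgt.
    by rewrite h ltnn.
  by rewrite -h ltnn.
have e2 m k : (na y m).2 k = (na z m).2 k.
  apply: injkc; apply/funext => j.
  exact: (congr1 (fun f => f (m, k.+1, j)) e).
apply: (@qlim_unique (fun m => lincomb v (na y m).2 (na y m).1)).
- by move=> m; exact: lincomb_in.
- by case: Wy.
- by case: Wz.
- exact: Hna.
- apply: null_seq_le (Hna z Wz) => m; rewrite e1.
  by rewrite (eq_lincomb _ (fun k _ => e2 m k)).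
Qed.

(** Gathers the results of the section, so that its hypotheses on scalars and quasi-norm are
    discharged only once. *)
Lemma span_closure_continuum v (kc : K -> nat -> bool) :
  (forall k, E (v k)) -> independent v -> injective kc ->
  let W := span_closure v in
  [/\ (forall k, W (v k)) /\ W 0,
      (forall x y, W x -> W y -> W (x + y)) /\ (forall (c : K) x, W x -> W (c *: x)),
      forall (x : nat -> V) y, E y -> (forall n, W (x n)) ->
        null_seq (fun n => N (x n - y)) -> W y,
      exists g : V -> nat * nat * nat -> bool, {in W &, injective g} &
      exists w : (nat -> bool) -> V, (forall b, W (w b)) /\
      forall m (c : 'I_m -> K) (b : 'I_m -> nat -> bool), injective b ->
        \sum_(i < m) c i *: w (b i) = 0 -> forall i, c i = 0].
Proof.
move=> Ev indv injkc W; split.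
- split; first by move=> k; exact: span_closure_gen.
  by rewrite -(scale0r (v 0%N)); apply: span_closureZ => //; exact: span_closure_gen.
- by split=> [x y|a x]; [exact: span_closureD | exact: span_closureZ].
- by move=> x y; exact: span_closure_closed.
- exact: (span_closure_inj Ev injkc).
- exact: continuum_family.
Qed.

End QuasiBanach.

(** * Bases and cardinality *)

Section Basis.
Variables (K : numFieldType) (Z : lmodType K).
Implicit Types (B W : set (nat -> Z)) (x y : nat -> Z).

Lemma lsumE n (c : 'I_n -> K) (v : 'I_n -> nat -> Z) :
  (fun j => \sum_(i < n) c i *: v i j) = \sum_(i < n) c i *: v i.
Proof. by rewrite fct_sumE. Qed.

Lemma lin_subspace_sum W n (c : 'I_n -> K) (v : 'I_n -> nat -> Z)
    (P : pred 'I_n) : lin_subspace W -> (forall i, P i -> W (v i)) ->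
  W (\sum_(i < n | P i) c i *: v i).
Proof.
move=> [W0 WD WZ] Wv; elim/big_ind : _ => // i Pi.
by apply: WZ; exact: Wv.
Qed.

Lemma lspan_min B W : lin_subspace W -> B `<=` W -> lspan B `<=` W.
Proof.
move=> sW BW _ [n [c [v [Bv ->]]]]; rewrite lsumE.
by apply: lin_subspace_sum => // i _; exact: BW.
Qed.

Lemma lspan_subspace B : lin_subspace (lspan B).
Proof.
split.
- exists 0%N, (fun=> 0), (fun=> szero); split; first by case.
  by apply/funext => j; rewrite big_ord0.
- move=> _ _ [n [c [v [Bv ->]]]] [m [d [w [Bw ->]]]].
  exists (n + m)%N, (fun i => match fintype.split i with inl j => c j | inr j => d j end),
    (fun i => match fintype.split i with inl j => v j | inr j => w j end); split.
    by move=> i; case: fintype.split.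
  apply/funext => j; rewrite /sadd big_split_ord /=; congr (_ + _);
    apply: eq_bigr => i _.
    by rewrite (unsplitK (inl i : 'I_n + 'I_m)).
  by rewrite (unsplitK (inr i : 'I_n + 'I_m)).
- move=> a _ [n [c [v [Bv ->]]]]; exists n, (fun i => a * c i), v; split=> //.
  apply/funext => j; rewrite /sscale scaler_sumr; apply: eq_bigr => i _.
  by rewrite scalerA.
Qed.

Lemma lspan_gen B : B `<=` lspan B.
Proof.
move=> x Bx; exists 1%N, (fun=> 1), (fun=> x); split=> //.
by apply/funext => j; rewrite big_ord1 scale1r.
Qed.

Lemma lin_indep_setU1 B y : lin_indep B -> ~ lspan B y ->
  lin_indep (B `|` [set y]).
Proof.
move=> indB nBy n c v injv Bv sum0.
have [[i0 vi0]|nv] := pselect (exists i0, v i0 = y); last first.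
  apply: (indB n c v) => // i; have [//|vi] := Bv i.
  by exfalso; apply: nv; exists i.
case: n i0 c v injv Bv sum0 vi0 => [[]//|n] i0 c v injv Bv sum0 vi0.
have Bl i : B (v (lift i0 i)).
  have [//|vi] := Bv (lift i0 i); exfalso.
  have /injv/eqP : v i0 = v (lift i0 i) by rewrite vi0 vi.
  by apply/negP; exact: neq_lift.
have sumE : c i0 *: y + \sum_(i < n) c (lift i0 i) *: v (lift i0 i) = 0.
  by move: sum0; rewrite lsumE (bigD1_ord i0) //= vi0.
have c0 : c i0 = 0.
  apply: contrapT => /eqP c0; apply: nBy.
  have -> : y = - (c i0)^-1 *: \sum_(i < n) c (lift i0 i) *: v (lift i0 i).
    move/eqP: sumE; rewrite addrC addr_eq0 => /eqP ->.
    by rewrite scalerN scaleNr opprK scalerA mulVf // scale1r.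
  have [_ _ sZ] := lspan_subspace B; apply: sZ; rewrite -lsumE.
  by exists n, (fun i => c (lift i0 i)), (fun i => v (lift i0 i)).
move: sumE; rewrite c0 scale0r add0r -lsumE => sumE i.
have injl : injective (fun i => v (lift i0 i)).
  by move=> j k /injv; exact: lift_inj.
have cl := indB _ _ _ injl Bl sumE.
by case: (unliftP i0 i) => [j|] ->.
Qed.

Lemma basis_extension L W : lin_subspace W -> lin_indep L -> L `<=` W ->
  exists B, [/\ L `<=` B, B `<=` W, lin_indep B & lspan B = W].
Proof.
move=> sW indL LW.
(* Zorn's lemma is applied to the sets to be added to [L], so that the union of the empty chain,
   which is empty, is admissible. *)
pose P : set (set (nat -> Z)) := [set A | A `<=` W /\ lin_indep (L `|` A)].
have [|A [[AW indA] Amax]] := @Zorn_bigcup _ P.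
  move=> F FP totF; split=> [x [X FX Xx]|]; first exact: (FP X FX).1.
  move=> n c v injv Bv sum0.
  (* Finitely many vectors outside [L] lie in a single member of the chain; [set0] covers the case
     where all of them lie in [L]. *)
  suff [X [[->|FX] Xv]] : exists X, (X = set0 \/ F X) /\
      forall i, (L `|` X) (v i).
  - by apply: (indL n c v) => // i; have [|] := Xv i.
  - exact: ((FP X FX).2 n c v).
  suff H m : exists X, (X = set0 \/ F X) /\
      forall i : 'I_n, (i < m)%N -> (L `|` X) (v i).
    by have [X [h hX]] := H n; exists X; split=> // i; exact: hX.
  elim: m => [|m [X [hX Xv]]]; first by exists set0; split=> //; left.
  have [mn|mn] := ltnP m n; last first.
    by exists X; split=> // i _; apply: Xv; exact: leq_trans (ltn_ord i) mn.
  have [Lv|[Y FY Yv]] := Bv (Ordinal mn).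
    exists X; split=> // i; rewrite ltnS leq_eqVlt => /orP[/eqP im|]; last exact: Xv.
    by left; rewrite (_ : i = Ordinal mn) //; exact: val_inj.
  have [XY|YX] : X `<=` Y \/ Y `<=` X.
    case: hX => [->|FX]; first by left.
    exact: totF.
    exists Y; split; first by right.
    move=> i; rewrite ltnS leq_eqVlt => /orP[/eqP im|/Xv].
      by right; rewrite (_ : i = Ordinal mn) //; exact: val_inj.
    by case; [left|right; exact: XY].
  exists X; split=> // i; rewrite ltnS leq_eqVlt => /orP[/eqP im|/Xv //].
  by right; apply: YX; rewrite (_ : i = Ordinal mn) //; exact: val_inj.
have BW : L `|` A `<=` W by move=> x [/LW|/AW].
exists (L `|` A); split=> //.
apply/seteqP; split; first exact: lspan_min.
move=> y Wy; apply: contrapT => nBy; apply: (Amax (A `|` [set y])).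
  split; first by move=> x; left.
  move=> /(_ y (or_intror erefl)) Ay; apply: nBy.
  by apply: lspan_gen; right.
split; first by move=> x [/AW //|->].
rewrite setUA; exact: lin_indep_setU1.
Qed.

End Basis.

(** A real number is determined by the rationals below it. *)
Lemma real_cut_inj (R : realType) :
  exists f : R -> nat -> bool, injective f.
Proof.
exists (fun x n => if unpickle n is Some q then ratr q < x else false).
have H (x y : R) : (forall n, (if @unpickle rat n is Some q then ratr q < x else false)
    = (if @unpickle rat n is Some q then ratr q < y else false)) -> y <= x.
  move=> e; rewrite leNgt; apply/negP => /rat_in_itvoo[q].
  rewrite in_itv /= => /andP[xq qy].
  by have := e (pickle q); rewrite pickleK qy ltNge ltW.
move=> x y e; apply/eqP; rewrite eq_le; apply/andP; split; apply: H => n.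
  exact: (congr1 (fun f => f n) (esym e)).
exact: (congr1 (fun f => f n) e).
Qed.

(** Digits 0 and 1 are read in base 3: at the first difference, at index [n], the digit 1
    contributes [1 / 3 ^+ n], whereas all later digits together contribute at most half of that. *)
Lemma ternary_inj (R : realType) :
  exists f : (nat -> bool) -> R, injective f.
Proof.
pose S (b : nat -> bool) n : R := \sum_(i < n) (b i)%:R / 3 ^+ i.
have S_S b n : S b n.+1 = S b n + (b n)%:R / 3 ^+ n by rewrite /S big_ord_recr.
have p0 n : 0 < 3 ^+ n :> R by rewrite exprn_gt0.
have S_le b n m : (n <= m)%N -> S b n <= S b m.
  move=> /subnKC <-; elim: (m - n)%N => [|k IH]; first by rewrite addn0.
  by rewrite addnS S_S (le_trans IH) // lerDl divr_ge0 // ltW.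
have S_tail b n m : S b (n + m)%N <= S b n + 3 / 2 / 3 ^+ n.
  suff : S b (n + m)%N + 3 / 2 / 3 ^+ (n + m)%N <= S b n + 3 / 2 / 3 ^+ n.
    by apply: le_trans; rewrite lerDl !divr_ge0 // ltW.
  elim: m => [|m IH]; first by rewrite addn0.
  apply: le_trans IH; rewrite addnS S_S exprS invfM.
  have := p0 (n + m)%N; rewrite -invr_gt0; set t := (3 ^+ _)^-1 => t0.
  by case: (b _); rewrite /= ?mul1r ?mul0r; lra.
pose f b := sup (range (S b)).
have S_sup b : has_sup (range (S b)).
  split; first by exists (S b 0%N), 0%N.
  exists (3 / 2) => _ [m _ <-]; have := S_tail b 0%N m.
  by rewrite add0n /S big_ord0 add0r expr0 divr1.
have f_ge b n : S b n <= f b by apply: (sup_upper_bound (S_sup b)); exists n.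
have f_le b n : f b <= S b n + 3 / 2 / 3 ^+ n.
  apply: sup_le_ub; first by exists (S b 0%N), 0%N.
  move=> _ [m _ <-]; have [nm|mn] := leqP n m; first by rewrite -(subnKC nm).
  by apply: le_trans (S_le b m n (ltnW mn)) _; rewrite lerDl !divr_ge0 // ltW.
have Hlt (b b' : nat -> bool) n : (forall i, (i < n)%N -> b i = b' i) -> b n -> ~~ b' n ->
    f b' < f b.
  move=> e bn b'n; apply: le_lt_trans (f_le b' n.+1) _.
  apply: lt_le_trans (f_ge b n.+1); rewrite !S_S bn (negbTE b'n).
  have -> : S b n = S b' n by apply: eq_bigr => i _; rewrite e.
  rewrite exprS invfM; have := p0 n; rewrite -invr_gt0; set t := (3 ^+ _)^-1 => t0.
  by rewrite /= ?mul1r ?mul0r; lra.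
exists f => b b' fbb'; apply/funext => n; elim/ltn_ind: n => n IH.
case bn: (b n); case b'n: (b' n) => //.
  by have := Hlt b b' n IH bn (negbT b'n); rewrite fbb' ltxx.
have := Hlt b' b n (fun i h => esym (IH i h)) b'n (negbT bn).
by rewrite fbb' ltxx.
Qed.


Lemma inj_card_leT T (U : pointedType) (A : set T) (f : T -> U) :
  {in A &, injective f} -> (A #<= [set: U])%card.
Proof. by move=> injf; apply/pcard_injP; exists f. Qed.

Lemma inj_card_le_sub T U (A : set U) (f : T -> U) :
  injective f -> (forall x, A (f x)) -> ([set: T] #<= A)%card.
Proof.
move=> injf Af.
have /inj_card_eq/card_eqPle[_ h] : {in [set: T] &, injective f} by exact: in2W.
by apply: card_le_trans h (subset_card_le _) => _ [x _ <-].
Qed.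

(** * The real and complex scalars *)

(** The limit is found as the lower limit: [A] is the set of eventual lower bounds of the
    sequence. *)
Lemma real_complete (R : realType) (a : nat -> R) :
  (forall e : R, 0 < e -> exists n0, forall m n, (n0 <= m)%N -> (n0 <= n)%N ->
     `|a m - a n| < e) ->
  exists l, null_seq (fun n => `|a n - l|).
Proof.
move=> ca; pose A := [set x | exists n0, forall n, (n0 <= n)%N -> x <= a n].
have key (e : R) : 0 < e -> exists n0, A (a n0 - e) /\ ubound A (a n0 + e) /\
    forall n, (n0 <= n)%N -> `|a n - a n0| < e.
  move=> e0; have [n0 h] := ca _ e0; exists n0; split; last split.
  - exists n0 => n hn; have := h n0 n (leqnn _) hn.
    by rewrite ltr_norml; lra.
  - move=> x [n1 hx]; have := hx _ (leq_maxr n0 n1).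
    have := h _ n0 (leq_maxl n0 n1) (leqnn _).
    by rewrite ltr_norml; lra.
  - by move=> n hn; apply: h.
have supA : has_sup A.
  have [n0 [h1 [h2 _]]] := key 1 ltr01; split; first by eexists; exact: h1.
  by eexists; exact: h2.
exists (sup A) => e e0; have e3 : 0 < e / 3 by lra.
have [n0 [h1 [h2 h3]]] := key _ e3; exists n0 => n /h3.
have := sup_upper_bound supA h1; have := sup_le_ub supA.1 h2.
by rewrite !ltr_norml => *; lra.
Qed.

Section ScalarField.
Local Notation R := Rdefinitions.R.

Definition scalar_of_real b : R -> KK b :=
  if b is true then id else fun r => real_complex R r.
(** Norms take their values in [KK b] itself. On nonnegative elements, which are real, this map
    inverts [scalar_of_real] and is multiplicative, so norms can be handled in the reals. *)
Definition real_part b : KK b -> R :=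
  if b is true then id else @complex.Re R.
Definition abs b (a : KK b) : R := real_part `|a|.

Variable b : bool.
Implicit Types (r s : R) (x y : KK b).

Lemma real_part_of_real r : real_part (scalar_of_real b r) = r.
Proof. by case: b. Qed.

Lemma scalar_of_real0 : scalar_of_real b 0 = 0. Proof. by case: b. Qed.

Lemma scalar_of_real1 : scalar_of_real b 1 = 1. Proof. by case: b. Qed.

Lemma scalar_of_realM r s :
  scalar_of_real b (r * s) = scalar_of_real b r * scalar_of_real b s.
Proof. by case: b => //=; exact: rmorphM. Qed.

Lemma scalar_of_realK x : 0 <= x -> scalar_of_real b (real_part x) = x.
Proof.
case: b x => //= -[u v]; rewrite lecE /= => /andP[/eqP -> _] //.
Qed.

Lemma scalar_of_real_lt r s : (scalar_of_real b r < scalar_of_real b s) = (r < s).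
Proof. by case: b => //=; exact: ltcR. Qed.

Lemma scalar_of_real_le r s : (scalar_of_real b r <= scalar_of_real b s) = (r <= s).
Proof. by case: b => //=; exact: lecR. Qed.

Lemma real_partD x y : real_part (x + y) = real_part x + real_part y.
Proof. by case: b x y => //= -[u v] [u' v']. Qed.

Lemma real_part_le x y : x <= y -> real_part x <= real_part y.
Proof. by case: b x y => //= x y; rewrite lecE => /andP[]. Qed.

Lemma real_part_ge0 x : 0 <= x -> 0 <= real_part x.
Proof. by move/real_part_le; rewrite -scalar_of_real0 real_part_of_real. Qed.

Lemma real_part_eq0 x : 0 <= x -> real_part x = 0 -> x = 0.
Proof.
move/scalar_of_realK => <-; rewrite real_part_of_real => ->.
exact: scalar_of_real0.
Qed.

Lemma real_partM x y : 0 <= x -> 0 <= y ->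
  real_part (x * y) = real_part x * real_part y.
Proof.
move=> x0 y0; rewrite -[in LHS](scalar_of_realK x0) -[in LHS](scalar_of_realK y0).
by rewrite -scalar_of_realM real_part_of_real.
Qed.

Lemma real_part_lt x r : 0 <= x -> (x < scalar_of_real b r) = (real_part x < r).
Proof. by move/scalar_of_realK => e; rewrite -[in LHS]e scalar_of_real_lt. Qed.

Lemma abs_ge0 x : 0 <= abs x. Proof. exact/real_part_ge0/normr_ge0. Qed.

Lemma abs_eq0 x : abs x = 0 -> x = 0.
Proof. by move/(real_part_eq0 (normr_ge0 _)) => /normr0_eq0. Qed.

Lemma abs0 : abs (0 : KK b) = 0.
Proof. by rewrite /abs normr0 -scalar_of_real0 real_part_of_real. Qed.

Lemma abs1 : abs (1 : KK b) = 1.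
Proof. by rewrite /abs normr1 -scalar_of_real1 real_part_of_real. Qed.

Lemma absN x : abs (- x) = abs x. Proof. by rewrite /abs normrN. Qed.

Lemma absM x y : abs (x * y) = abs x * abs y.
Proof. by rewrite /abs normrM real_partM. Qed.

Lemma abs_of_real r : 0 <= r -> abs (scalar_of_real b r) = r.
Proof.
move=> r0; rewrite /abs ger0_norm ?real_part_of_real //.
by rewrite -scalar_of_real0 scalar_of_real_le.
Qed.

End ScalarField.

Lemma abs_complete b (a : nat -> KK b) :
  (forall e : Rdefinitions.R, 0 < e -> exists n0, forall m n,
     (n0 <= m)%N -> (n0 <= n)%N -> abs (a m - a n) < e) ->
  exists l, null_seq (fun n => abs (a n - l)).
Proof.
case: b a => a ca; first exact: real_complete.
have absE (z : KK false) :
    abs z = Num.sqrt (complex.Re z ^+ 2 + complex.Im z ^+ 2).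
  exact: (congr1 (@complex.Re _) (normc_def z)).
have ReB (y z : KK false) : complex.Re (y - z) = complex.Re y - complex.Re z.
  by case: y; case: z.
have ImB (y z : KK false) : complex.Im (y - z) = complex.Im y - complex.Im z.
  by case: y; case: z.
have hRe (z : KK false) : `|complex.Re z| <= abs z.
  by rewrite absE -sqrtr_sqr ler_wsqrtr // lerDl sqr_ge0.
have hIm (z : KK false) : `|complex.Im z| <= abs z.
  by rewrite absE -sqrtr_sqr ler_wsqrtr // lerDr sqr_ge0.
have habs (z : KK false) : abs z <= `|complex.Re z| + `|complex.Im z|.
  rewrite absE -[leRHS]ger0_norm ?addr_ge0 // -(sqrtr_sqr (_ + _)) ler_wsqrtr //.
  rewrite -[X in X + _ <= _]real_normK ?num_real //.
  rewrite -[X in _ + X <= _]real_normK ?num_real //.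
  have := normr_ge0 (complex.Re z); have := normr_ge0 (complex.Im z); nra.
have [|p hp] := @real_complete _ (fun n => complex.Re (a n)).
  move=> e /ca[n0 h]; exists n0 => m n hm hn; rewrite -ReB.
  exact: le_lt_trans (hRe _) (h _ _ hm hn).
have [|q hq] := @real_complete _ (fun n => complex.Im (a n)).
  move=> e /ca[n0 h]; exists n0 => m n hm hn; rewrite -ImB.
  exact: le_lt_trans (hIm _) (h _ _ hm hn).
exists (Complex p q); apply: null_seq_le (null_seqD hp hq) => n.
by apply: le_trans (habs _) _; rewrite ReB ImB.
Qed.

Lemma scalar_inj b : exists f : KK b -> nat -> bool, injective f.
Proof.
have [f injf] := real_cut_inj Rdefinitions.R.
case: b; first by exists f.
exists (fun z n => if odd n then f (complex.Re z) n./2 else f (complex.Im z) n./2).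
move=> [x y] [x' y'] e.
have ex : x = x'.
  apply: injf; apply/funext => n; have := congr1 (fun g => g n.*2.+1) e.
  by rewrite /= odd_double /= uphalf_double.
have ey : y = y'.
  apply: injf; apply/funext => n; have := congr1 (fun g => g n.*2) e.
  by rewrite /= odd_double /= doubleK.
by rewrite ex ey.
Qed.

(** * Closed spans in quasi-Banach sequence spaces *)

Section ClosedSpan.
Variables (b : bool) (Z : lmodType (KK b)).
Variables (E : set (nat -> Z)) (qn : (nat -> Z) -> KK b).
Hypothesis qbE : quasi_banach E qn.

Definition closed_span (v : nat -> nat -> Z) : set (nat -> Z) :=
  span_closure E (fun x => real_part (qn x)) v.

(** For the dimension, a basis is chosen to contain the independent family [w] indexed by binary
    sequences, which gives at least continuum many elements; the coding of the whole closed span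
    gives at most as many. *)
Lemma closed_span_theory v : (forall k, E (v k)) -> independent v ->
  [/\ closed_subspace E qn (closed_span v), dim_continuum (closed_span v) &
      forall k, closed_span v (v k)].
Proof.
move=> Ev indv; case: qbE => -[E0 ED EZ] qn0 qnZ [C [C1 qnD]] Ecomp.
have qn_ge0 x : E x -> 0 <= qn x by move=> /qn0[].
have EB x y : E x -> E y -> E (x - y).
  by move=> Ex Ey; apply: ED => //; rewrite -scaleN1r; exact: EZ.
have null_conv u y : (forall n, E (u n)) -> E y ->
    qconv qn u y <-> null_seq (fun n => real_part (qn (u n - y))).
  move=> Eu Ey; split=> h e e0.
    have [|n0 hn0] := h (scalar_of_real b e).
      by rewrite -scalar_of_real0 scalar_of_real_lt.
    by exists n0 => n /hn0; rewrite real_part_lt //; apply/qn_ge0/EB.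
  have e1 : scalar_of_real b (real_part e) = e by rewrite scalar_of_realK // ltW.
  have [|n0 hn0] := h (real_part e).
    by rewrite -(scalar_of_real_lt b) e1 scalar_of_real0.
  exists n0 => n /hn0; rewrite -(real_part_lt (b := b)) ?e1 //.
  exact/qn_ge0/EB.
have [kc injkc] := scalar_inj b.
have := @span_closure_continuum _ _ (@abs b) (@abs_ge0 b) (@abs_eq0 b)
  (@abs0 b) (@abs1 b) (@absN b) (@absM b) (@abs_complete b) _
  (@abs_of_real b) _ E (fun x => real_part (qn x)) (real_part C) E0 ED EZ
  _ _ _ _ _ _ v kc Ev indv injkc.
case.
- by move=> x Ex; exact/real_part_ge0/qn_ge0.
- by move=> x Ex /(real_part_eq0 (qn_ge0 _ Ex)); have [_ [+ _]] := qn0 _ Ex.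
- move=> a x Ex; rewrite -[a *: x]/(sscale a x) qnZ //.
  by rewrite real_partM // qn_ge0.
- by rewrite -[1](real_part_of_real b) scalar_of_real1; exact: real_part_le.
- move=> x y Ex Ey; rewrite -real_partD -real_partM.
  + exact/real_part_le/qnD.
  + exact: le_trans ler01 C1.
  + by rewrite addr_ge0 // qn_ge0.
- move=> u Eu cu; have [|y [Ey uy]] := Ecomp u Eu.
    move=> e e0.
    have e1 : scalar_of_real b (real_part e) = e by rewrite scalar_of_realK // ltW.
    have [|n0 hn0] := cu (real_part e).
      by rewrite -(scalar_of_real_lt b) e1 scalar_of_real0.
    exists n0 => m n hm hn; have := hn0 m n hm hn.
    rewrite -(real_part_lt (b := b)) ?e1 //; exact/qn_ge0/EB.
  by exists y; split=> //; apply/null_conv.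
rewrite -/(closed_span v) => -[Wv W0] [WD WZ] Wclosed [g injg] [w [Ww indw]].
have WE : closed_span v `<=` E by move=> x [].
have sW : lin_subspace (closed_span v) by split.
split=> //.
  split=> // u y Wu Ey /null_conv uy; apply: (Wclosed u) => //.
  by apply: uy => // n; exact: WE.
(* Two equal values at distinct indices would satisfy the relation with coefficients 1 and -1. *)
have wI : injective w.
  move=> c c' cc'; apply: contrapT => ncc'.
  have inj2 : injective (fun i : 'I_2 => if i == ord0 then c else c').
    move=> i j; have [->|i0] := eqVneq i ord0; have [->|j0] := eqVneq j ord0 => //.
    - by move=> /esym.
    - by move=> _; case: i j i0 j0 => [[|[|]]//] ? [[|[|]]//] ? _ _; exact: val_inj.
  have := indw _ (fun i => if i == ord0 then 1 else -1) _ inj2.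
  rewrite big_ord_recl big_ord1 /= cc' scale1r scaleN1r subrr => /(_ erefl ord0).
  by rewrite eqxx => /eqP; rewrite oner_eq0.
have indL : lin_indep (range w).
  move=> n c x injx Lx; rewrite lsumE => sum0.
  have /choice[d Hd] : forall i, exists d, w d = x i.
    by move=> i; have [d _ dE] := Lx i; exists d.
  apply: (indw n c d).
    by move=> i j dij; apply: injx; rewrite -!Hd dij.
  by rewrite -[RHS]sum0; apply: eq_bigr => i _; rewrite Hd.
have LW : range w `<=` closed_span v by move=> _ [c _ <-].
have [B [LB BW indB spanB]] := basis_extension sW indL LW.
exists B; split=> //; apply: Cantor_Bernstein.
- have [h injh] := ternary_inj Rdefinitions.R.
  apply: (@inj_card_leT _ _ _ (fun x => h (fun n =>
    if unpickle n is Some t then g x t else false))).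
  move=> x y /set_mem/BW Wx /set_mem/BW Wy /injh e.
  apply: injg; [exact: mem_set | exact: mem_set |].
  apply/funext => t; have := congr1 (fun f => f (pickle t)) e.
  by rewrite pickleK.
- have [h injh] := real_cut_inj Rdefinitions.R.
  apply: (@inj_card_le_sub _ _ _ (w \o h)); first exact: inj_comp.
  by move=> r; apply: LB; exists (h r).
Qed.

(** Greedy choice: no finite set spans [E], so a vector outside the span of those already chosen
    always exists. *)
Lemma exists_independent_seq x : infinite_dimensional E -> E x ->
  exists v : nat -> nat -> Z, [/\ forall k, E (v k), independent v &
    x = szero \/ v 0%N = x].
Proof.
move=> infE Ex.
have [[E0 ED EZ] _ _ _ _] := qbE.
pose elts (s : seq (nat -> Z)) := [set y | exists2 i, (i < size s)%N & y = nth szero s i].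
have /choice[nxt Hnxt] : forall s : seq (nat -> Z), exists y,
    E y /\ ~ lspan (elts s) y.
  move=> s; apply: contrapT => h; apply: infE; exists (elts s); split.
    have -> : elts s = (nth szero s) @` `I_(size s).
      by apply/seteqP; split=> y [i /= ? e]; exists i => //; rewrite e.
    exact: finite_image.
  by move=> y Ey; apply: contrapT => ny; apply: h; exists y.
pose new s := if (s == [::]) && (x != szero) then x else nxt s.
(* The recursion carries the list of all earlier vectors, because the next choice depends on every
   one of them. A nonzero [x] is taken first. *)
pose s := fix s n := if n is m.+1 then rcons (s m) (new (s m)) else [::].
pose v n := new (s n).
have sz n : size (s n) = n by elim: n => //= n IH; rewrite size_rcons IH.
have sE n k : (k < n)%N -> nth szero (s n) k = v k.
  elim: n => // n IH; rewrite ltnS leq_eqVlt /= nth_rcons sz => /orP[/eqP ->|kn].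
    by rewrite ltnn eqxx.
  by rewrite kn IH.
have newE t : E (new t) /\ ~ lspan (elts t) (new t).
  rewrite /new; case: ifP => // /andP[/eqP -> /eqP x0]; split=> // lx; apply: x0.
  have sub0 : lin_subspace [set @szero _ Z].
    split=> // [y z -> ->|a y ->]; apply/funext => j.
      by rewrite /sadd addr0.
    by rewrite /sscale scaler0.
  by apply: (lspan_min sub0) lx => y [].
exists v; split.
- by move=> k; exact: (newE _).1.
- move=> n a; elim: n => // n IH lin0.
  have lsp : lspan (elts (s n)) (lincomb v a n).
    apply: lin_subspace_sum; first exact: lspan_subspace.
    move=> i _; apply: lspan_gen; exists i; first by rewrite sz.
    by rewrite sE.
  have an0 : a n = 0.
    apply: contrapT => /eqP an0; apply: (newE (s n)).2.
    have -> : new (s n) = - (a n)^-1 *: lincomb v a n.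
      move: lin0; rewrite lincombS => /eqP; rewrite addr_eq0 => /eqP ->.
      by rewrite scalerN scaleNr opprK scalerA mulVf // scale1r.
    by have [_ _] := lspan_subspace (elts (s n)); apply.
  move=> k; rewrite ltnS leq_eqVlt => /orP[/eqP -> //|]; apply: IH.
  by move: lin0; rewrite lincombS an0 scale0r addr0.
- have [->|/eqP x0] := pselect (x = szero); [by left | right].
  by rewrite /v /new /= x0.
Qed.

End ClosedSpan.

(** * Zero-free versions and subsequences *)

Definition strictly_increasing (phi : nat -> nat) :=
  forall n, (phi n < phi n.+1)%N.

Section StrictlyIncreasing.
Variable phi : nat -> nat.
Hypothesis phi_incr : strictly_increasing phi.

Lemma incr_leq i j : (phi i <= phi j)%N = (i <= j)%N.
Proof. exact: (leq_mono (homo_ltn ltn_trans phi_incr)). Qed.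

Lemma incr_ltn i j : (phi i < phi j)%N = (i < j)%N.
Proof. by rewrite !ltnNge incr_leq. Qed.

Lemma incr_inj : injective phi.
Proof. by move=> i j e; apply/eqP; rewrite eqn_leq -incr_leq -(incr_leq j) e leqnn. Qed.

Lemma incr_ge n : (n <= phi n)%N.
Proof. by elim: n => // n IH; apply: leq_ltn_trans IH (phi_incr n). Qed.

End StrictlyIncreasing.

Lemma strictly_increasing_comp phi psi :
  strictly_increasing phi -> strictly_increasing psi ->
  strictly_increasing (phi \o psi).
Proof. by move=> hphi hpsi n; rewrite /= incr_ltn. Qed.

Section ZeroFree.
Variables (K : numFieldType) (Z : lmodType K).
Implicit Types (u x : nat -> Z) (phi : nat -> nat).

Lemma not_finsupp x : ~ finsupp x ->
  forall n, exists j, (n <= j)%N && (x j != 0).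
Proof.
move=> nfx n; apply: contrapT => h; apply: nfx; exists n => j nj.
by apply: contrapT => /eqP xj; apply: h; exists j; rewrite nj.
Qed.

Lemma next_nzP x n : ~ finsupp x ->
  [/\ (n <= next_nz x n)%N, x (next_nz x n) != 0 &
      forall j, (n <= j)%N -> x j != 0 -> (next_nz x n <= j)%N].
Proof.
move=> /not_finsupp/(_ n) ex; rewrite /next_nz; case: pselect => // h.
case: ex_minnP => m /andP[nm xm] mmin; split=> // j nj xj.
by apply: mmin; rewrite nj.
Qed.

Lemma next_nz_unique x n m : ~ finsupp x -> (n <= m)%N -> x m != 0 ->
  (forall j, (n <= j)%N -> x j != 0 -> (m <= j)%N) -> next_nz x n = m.
Proof.
move=> nfx nm xm mmin; have [h1 h2 h3] := next_nzP n nfx.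
by apply/eqP; rewrite eqn_leq h3 // mmin.
Qed.

Definition spread phi u (j : nat) : Z :=
  if pselect (exists i, phi i = j) is left h then u (projT1 (cid h)) else 0.

Lemma spreadE phi u i : injective phi -> spread phi u (phi i) = u i.
Proof.
rewrite /spread => injphi; case: pselect => [h|[]]; last by exists i.
by case: (cid h) => j /= /injphi ->.
Qed.

Lemma spread0 phi u j : (forall i, phi i <> j) -> spread phi u j = 0.
Proof.
by move=> h; rewrite /spread; case: pselect => // hi; have [i /h] := hi.
Qed.

Lemma finsupp_spread phi u : strictly_increasing phi ->
  finsupp (spread phi u) <-> finsupp u.
Proof.
move=> hphi; split=> -[n hn].
  exists n => j nj; rewrite -(spreadE u j (incr_inj hphi)); apply: hn.
  exact: leq_trans nj (incr_ge hphi j).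
exists (phi n) => j nj.
have [[i ij]|h] := pselect (exists i, phi i = j).
  rewrite -ij spreadE; last exact: incr_inj.
  by apply: hn; rewrite -(incr_leq hphi) ij.
by apply: spread0 => i ij; apply: h; exists i.
Qed.

(** The last hypothesis says that [n'] cuts the range of [phi] where [n] cuts its domain. It is used
    for the pair 0, 0 and for the successors of [phi i] and [i]. *)
Lemma next_nz_spread phi u n n' : strictly_increasing phi -> ~ finsupp u ->
  (forall i, (n' <= phi i)%N = (n <= i)%N) ->
  next_nz (spread phi u) n' = phi (next_nz u n).
Proof.
move=> hphi nfu nn'; have [h1 h2 h3] := next_nzP n nfu.
have inj := incr_inj hphi.
apply: next_nz_unique => //.
- by move/(finsupp_spread _ hphi).
- by rewrite nn'.
- by rewrite spreadE.
- move=> j; have [[i <-]|h] := pselect (exists i, phi i = j).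
    by rewrite nn' spreadE // incr_leq //; exact: h3.
  by rewrite spread0 ?eqxx // => i ij; apply: h; exists i.
Qed.

Lemma zero_freeE u : ~ finsupp u -> zero_free u = fun k => u (nz_idx u k).
Proof. by move=> nfu; rewrite /zero_free; case: pselect. Qed.

Lemma zero_free_spread phi u : strictly_increasing phi -> ~ finsupp u ->
  zero_free (spread phi u) = zero_free u.
Proof.
move=> hphi nfu.
rewrite !zero_freeE //; last by move/(finsupp_spread _ hphi).
apply/funext => k; rewrite -(spreadE u (nz_idx u k) (incr_inj hphi)).
congr (spread phi u _); elim: k => [|k IH] /=; apply: next_nz_spread => // i.
by rewrite IH incr_ltn.
Qed.

Lemma zero_free_neq0 u : ~ finsupp u -> zero_free u <> szero.
Proof.
move=> nfu; rewrite zero_freeE // => /(congr1 (fun f => f 0%N)).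
by have [_ /eqP + _] := next_nzP 0 nfu; apply.
Qed.

End ZeroFree.

Section InvariantSpread.
Variables (K : numFieldType) (Z : normedModType K).
Variables (E : set (nat -> Z)) (qn : (nat -> Z) -> K).

(** Inserting zeros leaves the zero-free version unchanged, and membership depends on that version
    alone when it is nonzero; infinite support ensures the latter. *)
Lemma invariant_spread phi u : invariant_seq_space E qn ->
  strictly_increasing phi -> ~ finsupp u -> E (spread phi u) <-> E u.
Proof.
move=> [_ _ _ [C hC] _] hphi nfu.
have nfs : ~ finsupp (spread phi u) by move/(finsupp_spread _ hphi).
rewrite (hC u (zero_free_neq0 nfu)).1 (hC _ (zero_free_neq0 nfs)).1.
by rewrite zero_free_spread.
Qed.

Lemma strongly_invariant_spread phi u : strongly_invariant_seq_space E qn ->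
  strictly_increasing phi -> E u -> E (spread phi u).
Proof.
move=> [invE c00E _] hphi Eu; have [fu|nfu] := pselect (finsupp u).
  by apply: c00E; exact: (finsupp_spread u hphi).2.
exact: (invariant_spread invE hphi nfu).2.
Qed.

Lemma strongly_invariant_subseq phi u : strongly_invariant_seq_space E qn ->
  strictly_increasing phi -> E u -> E (u \o phi).
Proof. by move=> [_ _ subE] hphi /subE; apply. Qed.

(** [u] is the sum of its even and odd parts, each spread back to its original positions. *)
Lemma strongly_invariant_merge u : strongly_invariant_seq_space E qn ->
  E (fun i => u i.*2) -> E (fun i => u i.*2.+1) -> E u.
Proof.
move=> sE Ee Eo; have [[_ [[_ ED _] _ _ _ _] _ _ _] _ _] := sE.
have he : strictly_increasing double by move=> n; rewrite doubleS.
have ho : strictly_increasing (fun i => i.*2.+1) by move=> n; rewrite doubleS.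
have := ED _ _ (strongly_invariant_spread sE he Ee)
  (strongly_invariant_spread sE ho Eo).
congr (E _); apply/funext => j; rewrite /sadd.
case oj: (odd j).
  have jE : j = j./2.*2.+1 by rewrite -[LHS]odd_double_half oj.
  rewrite [in X in X + _]jE spread0 ?add0r; last first.
    by move=> i /(congr1 odd); rewrite /= !odd_double.
  by rewrite [in LHS]jE (spreadE _ _ (incr_inj ho)) -jE.
have jE : j = j./2.*2 by rewrite -[LHS]odd_double_half oj.
rewrite [in X in _ + X]jE (@spread0 _ _ (fun i => i.*2.+1)) ?addr0; last first.
  by move=> i /(congr1 odd); rewrite /= !odd_double.
by rewrite [in LHS]jE (spreadE _ _ (incr_inj he)) -jE.
Qed.

End InvariantSpread.

(** * Limits of multiples of a fixed vector *)

Section Lines.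
Variables (b : bool) (X : normedModType (KK b)).
Implicit Types (p q y z : X).

Definition norm_part z : Rdefinitions.R := real_part `|z|.

Lemma norm_part_ge0 (z : X) : 0 <= norm_part z.
Proof. exact/real_part_ge0/normr_ge0. Qed.

Lemma norm_part_eq0 (z : X) : norm_part z = 0 -> z = 0.
Proof. by move/(real_part_eq0 (normr_ge0 _))/normr0_eq0. Qed.

Lemma norm_partD (y z : X) : norm_part (y + z) <= norm_part y + norm_part z.
Proof. by rewrite /norm_part -real_partD; exact/real_part_le/ler_normD. Qed.

Lemma norm_partZ (a : KK b) (z : X) : norm_part (a *: z) = abs a * norm_part z.
Proof. by rewrite /norm_part normrZ real_partM. Qed.

Lemma norm_partN (z : X) : norm_part (- z) = norm_part z.
Proof. by rewrite /norm_part normrN. Qed.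

Lemma line_limit (a : nat -> KK b) l (p q : X) :
  null_seq (fun m => abs (a m - l)) -> null_seq (fun m => norm_part (q - a m *: p)) ->
  q = l *: p.
Proof.
move=> al aq; apply/subr0_eq/norm_part_eq0.
apply: null_seq_const; first exact: norm_part_ge0.
apply: null_seq_le (null_seqD aq (null_seqZ (norm_part_ge0 p) al)) => m.
rewrite mulrC -norm_partZ; apply: le_trans (norm_partD _ _).
by rewrite scalerBl addrA subrK.
Qed.

Lemma line_cauchy (a : nat -> KK b) (p q : X) : p != 0 ->
  null_seq (fun m => norm_part (q - a m *: p)) ->
  exists l, null_seq (fun m => abs (a m - l)).
Proof.
move=> p0 aq; apply: abs_complete => e e0.
have np0 : 0 < norm_part p.
  rewrite lt_neqAle norm_part_ge0 andbT eq_sym; apply/negP => /eqP/norm_part_eq0.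
  exact/eqP.
have [n0 hn0] := null_seqD aq aq (mulr_gt0 (divr_gt0 e0 (@ltr0Sn _ 1)) np0).
have hn n : (n0 <= n)%N -> norm_part (q - a n *: p) < e / 2 * norm_part p / 2.
  by move=> /hn0 /=; lra.
exists n0 => m n /hn hm /hn hn'.
rewrite -(ltr_pM2r np0) -norm_partZ scalerBl.
have -> : a m *: p - a n *: p = (q - a n *: p) - (q - a m *: p).
  by rewrite opprB [RHS]addrC subrKA.
apply: le_lt_trans (norm_partD _ _) _; rewrite norm_partN.
have := mulr_gt0 e0 np0; lra.
Qed.

End Lines.

(** * Disjoint copies of a sequence *)

Section Copies.
Variables (b : bool) (X : normedModType (KK b)).
Variables (x : nat -> X) (pos : nat -> nat -> nat).
Hypothesis pos_incr : forall k, strictly_increasing (pos k).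
Hypothesis pos_disj : forall k k' i i', pos k i = pos k' i' -> k = k'.

Definition copies (n : nat) : nat -> X :=
  if n is k.+1 then spread (pos k) x else x.

Lemma copiesS k i m : copies m.+1 (pos k i) = if m == k then x i else 0.
Proof.
rewrite /=; case: eqVneq => [->|mk]; first by rewrite spreadE //; exact: incr_inj.
by apply: spread0 => i' /pos_disj mk'; rewrite mk' eqxx in mk.
Qed.

Lemma copies_off j m : (forall k i, pos k i <> j) -> copies m.+1 j = 0.
Proof. by move=> h; apply: spread0. Qed.

Lemma lincomb_copies_off (a : nat -> KK b) n j : (forall k i, pos k i <> j) ->
  lincomb copies a n j = (if (0 < n)%N then a 0%N else 0) *: x j.
Proof.
move=> h; rewrite /lincomb fct_sumE; case: n => [|n].
  by rewrite big_ord0 scale0r.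
rewrite big_ord_recl big1 ?addr0 // => i _.
by rewrite -[LHS]/(a i.+1 *: copies i.+1 j) copies_off // scaler0.
Qed.

Lemma lincomb_copies_on (a : nat -> KK b) n k i :
  lincomb copies a n (pos k i) = (if (0 < n)%N then a 0%N else 0) *: x (pos k i) +
    (if (k.+1 < n)%N then a k.+1 else 0) *: x i.
Proof.
rewrite /lincomb fct_sumE; case: n => [|n].
  by rewrite big_ord0 !scale0r addr0.
rewrite big_ord_recl; congr (_ + _).
have E (m : 'I_n) : (a (lift ord0 m) *: copies (lift ord0 m)) (pos k i) =
    a m.+1 *: (if m == k :> nat then x i else 0).
  by rewrite -copiesS.
under eq_bigr do rewrite E.
rewrite ltnS; case: ltnP => [kn|nk].
  rewrite (bigD1 (Ordinal kn)) //= eqxx big1 ?addr0 // => m mk.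
  case: eqP => [e|_]; last exact: scaler0.
  by move: mk; rewrite -val_eqE /= e eqxx.
rewrite scale0r big1 // => m _; rewrite ifN ?scaler0 //.
by rewrite neq_ltn (leq_trans (ltn_ord m)).
Qed.

(** Coordinate [j] reveals the coefficient of [x]; once this is 0, coordinate [pos k j] reveals that
    of the copy along [pos k]. *)
Lemma copies_independent j : (forall k i, pos k i <> j) -> x j != 0 ->
  independent copies.
Proof.
move=> hj xj n a lin0.
have a0 : (if (0 < n)%N then a 0%N else 0) = 0.
  have := lincomb_copies_off a n hj; rewrite lin0 => /esym/eqP.
  by rewrite scaler_eq0 (negbTE xj) orbF => /eqP.
case=> [n0|k kn]; first by rewrite n0 in a0.
have := lincomb_copies_on a n k j.
rewrite lin0 a0 scale0r add0r kn => /esym/eqP.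
by rewrite scaler_eq0 (negbTE xj) orbF => /eqP.
Qed.

(** Coordinates are dominated by the quasi-norm, so approximating combinations converge
    coordinatewise. Convergence of their coefficients is read at coordinates where [x] or a copy
    takes the nonzero value [x j], and the limits then describe [w] at all coordinates. *)
Lemma closed_span_copies (E : set (nat -> X)) qn j :
  quasi_banach E qn -> (forall y, E y -> forall i, `|y i| <= qn y) ->
  (forall k, E (copies k)) -> (forall k i, pos k i <> j) -> x j != 0 ->
  forall w, closed_span E qn copies w -> exists (l : KK b) (c : nat -> KK b),
    (forall j, (forall k i, pos k i <> j) -> w j = l *: x j) /\
    (forall k i, w (pos k i) = l *: x (pos k i) + c k *: x i).
Proof.
move=> qbE coordE Ec hj xj w [Ew happ].
have [[E0 ED EZ] _ _ _ _] := qbE.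
have Elin n a : E (lincomb copies a n) by exact: lincomb_in.
have /choice[na Hna] : forall m : nat, exists na : nat * (nat -> KK b),
    real_part (qn (w - lincomb copies na.2 na.1)) < m.+1%:R^-1.
  move=> m; have [|n [a h]] := happ m.+1%:R^-1; first by rewrite invr_gt0.
  by exists (n, a).
(* The effective coefficients: indices beyond the length of the combination count as 0. *)
pose A m k : KK b := if (k < (na m).1)%N then (na m).2 k else 0.
have conv i : null_seq (fun m => norm_part
    (w i - lincomb copies (na m).2 (na m).1 i)).
  apply: null_seq_le (@null_seq_inv Rdefinitions.R) => m.
  apply: le_trans (ltW (Hna m)); apply: real_part_le; apply: (coordE (w - _)).
  by apply: ED => //; rewrite -scaleN1r; apply/EZ/Elin.
have conv_off i : (forall k p, pos k p <> i) ->
    null_seq (fun m => norm_part (w i - A m 0%N *: x i)).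
  move=> hi; apply: null_seq_le (conv i) => m.
  by rewrite lincomb_copies_off.
have [l hl] := line_cauchy xj (conv_off j hj).
have conv_on k i :
    null_seq (fun m => norm_part (w (pos k i) - l *: x (pos k i) - A m k.+1 *: x i)).
  apply: null_seq_le (null_seqD (conv (pos k i))
    (null_seqZ (norm_part_ge0 (x (pos k i))) hl)) => m.
  rewrite lincomb_copies_on -/(A m 0%N) -/(A m k.+1) mulrC -norm_partZ.
  apply: le_trans (norm_partD _ _); rewrite le_eqVlt.
  apply/orP; left; apply/eqP; congr (norm_part _).
  rewrite scalerBl opprD -[RHS]addrA [X in _ = _ + X]addrACA addNr add0r.
  by rewrite (addrC (- (A m k.+1 *: _))) addrA.
(* Coordinate [pos k j] is used, where the copy along [pos k] has the value [x j]. *)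
have /choice[c hc] : forall k, exists c, null_seq (fun m => abs (A m k.+1 - c)).
  by move=> k; exact: line_cauchy xj (conv_on k j).
exists l, c; split=> [i hi|k i]; first exact: line_limit hl (conv_off i hi).
apply/eqP; rewrite addrC -subr_eq; apply/eqP.
exact: line_limit (hc k) (conv_on k i).
Qed.

End Copies.

(** The positive integers of 2-adic valuation [k]; for different [k] these sets are disjoint. *)
Definition dyadic_pos (k i : nat) : nat := (2 ^ k * i.*2.+1)%N.

Lemma dyadic_pos_incr k : strictly_increasing (dyadic_pos k).
Proof. by move=> n; rewrite /dyadic_pos ltn_pmul2l ?expn_gt0 // doubleS. Qed.

Lemma dyadic_pos_disj k k' i i' : dyadic_pos k i = dyadic_pos k' i' -> k = k'.
Proof.
move=> /(congr1 (logn 2)); rewrite /dyadic_pos !lognM ?expn_gt0 // !pfactorK //.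
have odd_logn m : logn 2 m.*2.+1 = 0%N.
  by rewrite logn_coprime // coprime2n /= odd_double.
by rewrite !odd_logn !addn0.
Qed.

(** * The subspace through a given point, for nonempty and empty families *)

Section Main.
Variables (b : bool) (X Y : normedModType (KK b)) (Gam : Type).
Variables (E : set (nat -> X)) (qE : (nat -> X) -> KK b).
Variables (EL : Gam -> set (nat -> Y)) (qL : Gam -> (nat -> Y) -> KK b).
Variable f : X -> Y.
Hypothesis invE : invariant_seq_space E qE.
Hypothesis invEL : forall l, strongly_invariant_seq_space (EL l) (qL l).
Hypothesis compatEL : forall l, compatible f (EL l).
Hypothesis nestedEL : nested EL.

(** If the even part of [f x] were in [EL l] and the odd part in [EL l'], both would lie in the
    larger of these spaces, and merging them would put [f x] there. The other parity, [beta], is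
    left free for the copies. *)
Lemma avoiding_parity x : (forall l, ~ EL l (fun j => f (x j))) ->
  exists alpha beta, [/\ strictly_increasing alpha, strictly_increasing beta,
    forall i j, alpha i <> beta j &
    forall l, ~ EL l (fun i => f (x (alpha i)))].
Proof.
move=> fx.
have he : strictly_increasing double by move=> n; rewrite doubleS.
have ho : strictly_increasing (fun i => i.*2.+1) by move=> n; rewrite doubleS.
have eo i j : i.*2 <> j.*2.+1 by move/(congr1 odd); rewrite /= !odd_double.
have [hev|/existsNP[l /contrapT hl]] :=
    pselect (forall l, ~ EL l (fun i => f (x i.*2))).
  by exists double, (fun i => i.*2.+1).
exists (fun i => i.*2.+1), double; split=> // [i j /esym /eo //|l' hl'].
have [ll'|l'l] := nestedEL l l'.
  by apply: (fx l'); apply: strongly_invariant_merge (invEL l') _ hl'; exact: ll'.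
by apply: (fx l); apply: strongly_invariant_merge (invEL l) hl _; exact: l'l.
Qed.

Lemma nonempty_family_subspace x (l0 : Gam) : Gset E f EL x ->
  exists W, [/\ closed_subspace E qE W, dim_continuum W, W x &
                W `<=` Gset E f EL `|` [set szero]].
Proof.
move=> [Ex /forallNP fx]; have [f0 _] := compatEL l0.
have [alpha [beta [ha hb ab fxa]]] := avoiding_parity fx.
(* As [f 0 = 0], a finitely supported [u] has a finitely supported image, which belongs to
   [EL l0]. *)
have nfin (u : nat -> X) : ~ EL l0 (fun j => f (u j)) -> ~ finsupp u.
  move=> nu [n hn]; apply: nu; have [_ c00 _] := invEL l0; apply: c00.
  by exists n => j /hn ->.
have nfx := nfin x (fx l0).
have [j0 /andP[_ xj0]] := not_finsupp (nfin (x \o alpha) (fxa l0)) 0.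
(* Splits the range of [beta] into disjoint infinite pieces, all missing [alpha]. *)
pose pos k := beta \o dyadic_pos k.
have pos_incr k : strictly_increasing (pos k).
  by apply: strictly_increasing_comp => //; exact: dyadic_pos_incr.
have pos_disj k k' i i' : pos k i = pos k' i' -> k = k'.
  by move/(incr_inj hb); exact: dyadic_pos_disj.
have posa i k i' : pos k i' <> alpha i by move=> /esym/ab.
pose v := copies x pos.
have Ev k : E (v k).
  case: k => [|k] //; exact: (invariant_spread invE (pos_incr k) nfx).2.
have [_ qbE _ _ coordE] := invE.
have indv : independent v by exact: (copies_independent pos_incr pos_disj (posa j0) xj0).
have [clW dimW Wv] := closed_span_theory qbE Ev indv.
exists (closed_span E qE v); split=> //; first exact: (Wv 0%N).
move=> w Ww; have [cl_sub _ _] := clW.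
have Ew := cl_sub _ Ww.
have [a [c [w_off w_on]]] :=
  closed_span_copies pos_incr pos_disj qbE coordE Ev (posa j0) xj0 Ww.
(* If [f w] were in [EL l], so would be its subsequence along [phi], namely [f] of [d *: u], against
   compatibility. *)
have avoid (u : nat -> X) phi d : (forall l, ~ EL l (fun j => f (u j))) ->
    strictly_increasing phi -> d != 0 -> (forall i, w (phi i) = d *: u i) ->
    Gset E f EL w.
  move=> fu hphi d0 wu; split=> // -[l hl]; have [_ comp] := compatEL l.
  apply: (comp u d d0 (fu l)).
  have := strongly_invariant_subseq (invEL l) hphi hl.
  by congr (EL l _); apply/funext => i /=; rewrite wu.
(* If [a] is nonzero, [w] is examined along [alpha]; otherwise along a copy with [c k] nonzero; if
   there is none, [w] vanishes everywhere. *)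
have [a0|a0] := eqVneq a 0; last first.
  by left; apply: (avoid (x \o alpha) alpha a) => // i; exact: w_off.
have [[k /eqP ck]|nc] := pselect (exists k, c k <> 0).
  left; apply: (avoid x (pos k) (c k)) => // i.
  by rewrite w_on a0 scale0r add0r.
right; apply/funext => j.
have [[k [i <-]]|nj] := pselect (exists k i, pos k i = j).
  rewrite w_on a0 scale0r add0r (_ : c k = 0) ?scale0r //.
  by apply: contrapT => ck; apply: nc; exists k.
rewrite w_off ?a0 ?scale0r // => k i ij; apply: nj; by exists k, i.
Qed.

(** Here [x] may be zero or finitely supported, cases that [invariant_spread] does not cover, and
    any closed subspace of [E] satisfies the inclusion. *)
Lemma empty_family_subspace x : ~ (exists l : Gam, True) -> E x ->
  exists W, [/\ closed_subspace E qE W, dim_continuum W, W x &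
                W `<=` Gset E f EL `|` [set szero]].
Proof.
move=> noGam Ex; have [_ qbE infE _ _] := invE.
have [v [Ev indv vx]] := exists_independent_seq qbE infE Ex.
have [clW dimW Wv] := closed_span_theory qbE Ev indv.
have [WE [W0 _ _] _] := clW.
exists (closed_span E qE v); split=> //; first by case: vx => [->|<-].
by move=> w /WE Ew; left; split=> // -[l _]; apply: noGam; exists l.
Qed.

End Main.

Unset Implicit Arguments.
Set Strict Implicit.
Set Printing Implicit Defensive.

Theorem mainTheorem2 (b : bool)
    (X Y : completeNormedModType (KK b)) (Gam : Type)
    (E : set (nat -> X)) (qE : (nat -> X) -> KK b)
    (EL : Gam -> set (nat -> Y)) (qL : Gam -> (nat -> Y) -> KK b)
    (f : X -> Y) :
  invariant_seq_space E qE ->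
  (forall l, strongly_invariant_seq_space (EL l) (qL l)) ->
  (forall l, compatible f (EL l)) ->
  nested EL ->
  Gset E f EL = set0 \/
  (forall x, Gset E f EL x ->
     exists W : set (nat -> X),
       [/\ closed_subspace E qE W, dim_continuum W, W x &
           W `<=` Gset E f EL `|` [set szero]]).
Proof.
(* The second alternative holds in every case, vacuously when the set is empty. *)
move=> invE invEL compatEL nestedEL; right => x Gx.
have [[l _]|noGam] := pselect (exists l : Gam, True).
  exact: (nonempty_family_subspace invE invEL compatEL nestedEL l Gx).
by apply: (empty_family_subspace EL f invE noGam); case: Gx.
Qed.
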